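(* Let $K$ be a field of characteristic $0$, let $\mathfrak g,\mathfrak g'$ be Lie algebras over $K$, let $C$ be a cocommutative $K$-coalgebra and let $\Psi:C\to\mathrm{Hom}_K(\mathfrak g,\mathfrak g')$ be a measuring of Lie algebras from $\mathfrak g$ to $\mathfrak g'$. Then for each $x\in C$ the following diagram commutes: $$\begin{array}{ccc}H_\bullet(\mathfrak g)&\xrightarrow{\Delta_{\mathfrak g}}&H_\bullet(\mathfrak g)\otimes H_\bullet(\mathfrak g)\\ {\scriptstyle H^\Psi_\bullet(x)}\downarrow&&\downarrow{\scriptstyle H^\Psi_\bullet(x_{(1)})\otimes H^\Psi_\bullet(x_{(2)})}\\ H_\bullet(\mathfrak g')&\xrightarrow{\Delta_{\mathfrak g'}}&H_\bullet(\mathfrak g')\otimes H_\bullet(\mathfrak g')\end{array}$$ where $\Delta_C(x)=x_{(1)}\otimes x_{(2)}$, with summation suppressed.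
   Context: A measuring of Lie algebras from $(\mathfrak g,[\ ,\ ])$ to $(\mathfrak g',[\ ,\ ]')$ is a $K$-linear map $\Psi:C\to\mathrm{Hom}_K(\mathfrak g,\mathfrak g')$, $C$ a cocommutative $K$-coalgebra, with $\Psi(x)([\alpha,\beta])=[\Psi(x_{(1)})(\alpha),\Psi(x_{(2)})(\beta)]'$ for all $\alpha,\beta\in\mathfrak g$, $x\in C$. $H_\bullet(\mathfrak g)$ is the homology of the Chevalley–Eilenberg complex $CE_n(\mathfrak g)=\wedge^n\mathfrak g$, $n\ge0$, with $d(\alpha_1\wedge\cdots\wedge\alpha_n)=\sum_{i<j}(-1)^{i+j+1}[\alpha_i,\alpha_j]\wedge\alpha_1\wedge\cdots\hat\alpha_i\cdots\hat\alpha_j\cdots\wedge\alpha_n$. The map $H^\Psi_\bullet(x)$ is induced by the chain map $\alpha_1\wedge\cdots\wedge\alpha_n\mapsto\Psi(x_{(1)})(\alpha_1)\wedge\cdots\wedge\Psi(x_{(n)})(\alpha_n)$ (multiplication by $\epsilon_C(x)$ for $n=0$). The coproduct $\Delta_{\mathfrak g}$ is induced by the diagonal $\mathfrak g\to\mathfrak g\oplus\mathfrak g$, $\alpha\mapsto(\alpha,\alpha)$, together with the canonical isomorphisms $\wedge^n(\mathfrak g\oplus\mathfrak g)\cong\bigoplus_{p+q=n}\wedge^p\mathfrak g\otimes\wedge^q\mathfrak g$. *)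

(* Defs.v *)
From HB Require Import structures.
From mathcomp Require Import all_boot all_order all_algebra.
From mathcomp Require Import boolp classical_sets.
From mathcomp Require Import generic_quotient ring_quotient freeg zify.

Set Implicit Arguments.
Unset Strict Implicit.
Unset Printing Implicit Defensive.

Import GRing.Theory.
Local Open Scope ring_scope.
Local Open Scope classical_set_scope.
Local Open Scope quotient_scope.

Section Quotient.
Variables (K : fieldType) (V : lmodType K).

Definition lspan (S : set V) : {pred V} := fun v =>
  `[< forall U : {pred V}, submod_closed U ->
        (forall s, S s -> s \in U) -> v \in U >].

Lemma lspan_closed (S : set V) : submod_closed (lspan S).
Proof.
split=> [|a u v uS vS]; first by apply/asboolP => U [U0 _] _.
apply/asboolP => U cU SU; case: (cU) => _; apply.
- by move/asboolP: uS; apply.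
- by move/asboolP: vS; apply.
Qed.

HB.instance Definition _ (S : set V) :=
  GRing.isSubmodClosed.Build K V (lspan S) (lspan_closed S).

Definition lquot (S : set V) : Type := Quotient.quot (lspan S).
HB.instance Definition _ (S : set V) := GRing.Zmodule.on (lquot S).
HB.instance Definition _ (S : set V) := Quotient.on (lquot S).

Definition lpi (S : set V) (v : V) : lquot S := \pi_(lquot S) v.

Lemma lpiP (S : set V) (u v : V) : lpi S u = lpi S v <-> u - v \in lspan S.
Proof.
rewrite (Quotient.idealrBE (lspan S) u v).
by split=> [?|/eqP]; first exact/eqP.
Qed.

Lemma lpi_is_zmod (S : set V) : zmod_morphism (lpi S).
Proof. by move=> u v; rewrite /lpi !piE. Qed.
HB.instance Definition _ (S : set V) :=
  GRing.isZmodMorphism.Build V (lquot S) (lpi S) (lpi_is_zmod S).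

Definition lscale (S : set V) (a : K) (u : lquot S) : lquot S :=
  lpi S (a *: repr u).

Lemma lpiW (S : set V) (P : lquot S -> Prop) :
  (forall v, P (lpi S v)) -> forall u, P u.
Proof. by move=> PS u; rewrite -[u]reprK; apply: PS. Qed.

Lemma lpiZ (S : set V) a v : lscale a (lpi S v) = lpi S (a *: v).
Proof.
apply/lpiP; rewrite -scalerBr; apply: rpredZ.
by apply/lpiP; rewrite /lpi reprK.
Qed.

Fact lscaleA (S : set V) a b (v : lquot S) :
  lscale a (lscale b v) = lscale (a * b) v.
Proof. by elim/lpiW: v => v; rewrite !lpiZ scalerA. Qed.
Fact lscale1 (S : set V) : left_id 1 (@lscale S).
Proof. by elim/lpiW=> v; rewrite !lpiZ scale1r. Qed.
Fact lscaleDr (S : set V) : right_distributive (@lscale S) +%R.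
Proof.
move=> a; elim/lpiW=> u; elim/lpiW=> v.
by rewrite -raddfD !lpiZ scalerDr raddfD.
Qed.
Fact lscaleDl (S : set V) v : {morph (@lscale S)^~ v : a b / a + b}.
Proof. by elim/lpiW: v => v a b; rewrite !lpiZ scalerDl raddfD. Qed.
HB.instance Definition _ (S : set V) := GRing.Zmodule_isLmodule.Build K (lquot S)
  (@lscaleA S) (@lscale1 S) (@lscaleDr S) (@lscaleDl S).

Fact lpi_scalable (S : set V) : scalable (lpi S).
Proof. by move=> a v; rewrite -lpiZ. Qed.
HB.instance Definition _ (S : set V) :=
  GRing.isScalable.Build K V (lquot S) *:%R (lpi S) (lpi_scalable S).
End Quotient.


Section FreeModule.
Variables (K : fieldType) (X : choiceType) (W : lmodType K) (f : X -> W).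

HB.instance Definition _ :=
  GRing.isZmodMorphism.Build {freeg X / K} W (fglift f) (lift_is_additive f).

Fact fglift_scalable : scalable (fglift f).
Proof.
move=> a u; rewrite -[in RHS](freeg_sumE u) [a *: u]/(fgscale a u) /fgscale.
rewrite raddf_sum [X in _ = _ *: X]raddf_sum scaler_sumr.
by apply: eq_bigr => x _; rewrite /= !liftU scalerA.
Qed.

HB.instance Definition _ :=
  GRing.isScalable.Build K {freeg X / K} W *:%R (fglift f) fglift_scalable.
End FreeModule.

Section Presentation.
Variables (K : fieldType) (X : choiceType) (S : set {freeg X / K}).

(* The space generated by X subject to the relations r = 0 for r in S. *)
Definition pres : Type := lquot S.
HB.instance Definition _ := GRing.Lmodule.on pres.

Definition gen (x : X) : pres := lpi S << x >>.

Section Lift.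
Variables (W : lmodType K) (f : X -> W).

Definition respects := forall r, S r -> fglift f r = 0.

(* The linear map gen x |-> f x.  It exists only when f respects the relations;
   otherwise plift f is the zero map, so that plift is total and always linear.
   tlift, dlift, elift and glift below inherit this convention. *)
Definition plift (w : pres) : W :=
  if `[< respects >] then fglift f (repr (w : lquot S)) else 0.

Lemma fglift_lspan (fS : respects) r : r \in lspan S -> fglift f r = 0.
Proof.
move=> /asboolP/(_ (fun r => fglift f r == 0)) H; apply/eqP; apply: H.
  split=> [|a u v /eqP u0 /eqP v0]; apply/eqP; first exact: raddf0.
  by rewrite linearP /= u0 v0 scaler0 addr0.
by move=> s /fS s0; apply/eqP.
Qed.

Lemma plift_pi (fS : respects) r : plift (lpi S r) = fglift f r.
Proof.
rewrite /plift asboolT //; apply/eqP; rewrite -subr_eq0 -raddfB /=; apply/eqP.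
by apply: fglift_lspan => //; apply/lpiP; rewrite /lpi reprK.
Qed.

Lemma plift_gen (fS : respects) x : plift (gen x) = f x.
Proof. by rewrite plift_pi // liftU scale1r. Qed.

Fact plift_is_linear : linear plift.
Proof.
have [fS|fS] := pselect respects; last first.
  by move=> a u v; rewrite /plift asboolF // scaler0 addr0.
move=> a; elim/lpiW => u; elim/lpiW => v.
have -> : a *: lpi S u + lpi S v = lpi S (a *: u + v) by rewrite linearP.
by rewrite !plift_pi // linearP.
Qed.

HB.instance Definition _ :=
  GRing.isLinear.Build K pres W *:%R plift plift_is_linear.
End Lift.

Lemma pres_ind (P : pres -> Prop) :
  (forall a x w, P w -> P (a *: gen x + w)) -> P 0 -> forall w, P w.
Proof.
move=> PS P0; elim/lpiW => r; rewrite -[r]freeg_sumE.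
elim: (dom r) => [|x s IHs]; first by rewrite big_nil raddf0.
rewrite big_cons raddfD /=.
have -> : << coeff x r *g x >> = coeff x r *: << x >>.
  by apply/eqP/freeg_eqP => y; rewrite coeffZ !coeffU mul1r.
by rewrite linearZ; apply: PS.
Qed.
End Presentation.

Section Tensor.
Variable K : fieldType.

Section Def.
Variables V W : lmodType K.

Definition tensor_rel : set {freeg (V * W) / K} :=
  [set r | exists a v v' w,
     r = << (a *: v + v', w) >> - a *: << (v, w) >> - << (v', w) >>] `|`
  [set r | exists a v w w',
     r = << (v, a *: w + w') >> - a *: << (v, w) >> - << (v, w') >>].

Definition tensor : Type := pres tensor_rel.
HB.instance Definition _ := GRing.Lmodule.on tensor.

Definition tens (v : V) (w : W) : tensor := gen tensor_rel (v, w).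

Definition tlift (U : lmodType K) (f : V -> W -> U) : tensor -> U :=
  plift (S := tensor_rel) (fun vw => f vw.1 vw.2).
HB.instance Definition _ U f := GRing.Linear.on (@tlift U f).

Lemma tlift_tens (U : lmodType K) (f : V -> W -> U) :
  (forall a v v' w, f (a *: v + v') w = a *: f v w + f v' w) ->
  (forall a v w w', f v (a *: w + w') = a *: f v w + f v w') ->
  forall v w, tlift f (tens v w) = f v w.
Proof.
move=> fl fr v w; rewrite /tlift /tens plift_gen // => r.
by case=> [[a [u [u' [z ->]]]]|[a [u [z [z' ->]]]]];
  rewrite !linearB linearZ /= !liftU /= !scale1r ?fl ?fr
   [_ *: _ + _]addrC addrK subrr.
Qed.
End Def.
End Tensor.

Section DirectSum.
Variables (K : fieldType) (I : choiceType) (V : I -> lmodType K).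

Definition dsum_rel : set {freeg {i : I & V i} / K} :=
  [set r | exists i (a : K) (v w : V i),
     r = << Tagged V (a *: v + w) >> - a *: << Tagged V v >> - << Tagged V w >>].

Definition dsum : Type := pres dsum_rel.
HB.instance Definition _ := GRing.Lmodule.on dsum.

Definition dinj (i : I) (v : V i) : dsum := gen dsum_rel (Tagged V v).

Definition dlift (U : lmodType K) (f : forall i, V i -> U) : dsum -> U :=
  plift (S := dsum_rel) (fun iv => f (tag iv) (tagged iv)).
HB.instance Definition _ U f := GRing.Linear.on (@dlift U f).

Lemma dlift_inj (U : lmodType K) (f : forall i, V i -> U) :
  (forall i, linear (f i)) -> forall i v, dlift f (dinj v) = f i v.
Proof.
move=> fl i v; rewrite /dlift /dinj plift_gen // => r [j [a [u [w ->]]]].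
by rewrite !linearB linearZ /= !liftU /= !scale1r fl [_ *: _ + _]addrC addrK subrr.
Qed.
End DirectSum.

Section Exterior.
Variables (K : fieldType) (n : nat).

Section Def.
Variable V : lmodType K.

Definition upd (t : n.-tuple V) (i : 'I_n) (v : V) : n.-tuple V :=
  [tuple (if k == i then v else tnth t k) | k < n].

Definition ext_rel : set {freeg (n.-tuple V) / K} :=
  [set r | exists t i a u v,
     r = << upd t i (a *: u + v) >> - a *: << upd t i u >> - << upd t i v >>] `|`
  [set r | exists t i j, [/\ i != j, tnth t i = tnth t j & r = << t >>]].

Definition ext : Type := pres ext_rel.
HB.instance Definition _ := GRing.Lmodule.on ext.

(* Meant for lists of length n: other lists are truncated or padded with 0. *)
Definition wedge (s : seq V) : ext := gen ext_rel [tuple s`_i | i < n].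

Definition multilinear (U : lmodType K) (f : n.-tuple V -> U) :=
  forall t i a u v, f (upd t i (a *: u + v)) = a *: f (upd t i u) + f (upd t i v).
Definition alternating (U : lmodType K) (f : n.-tuple V -> U) :=
  forall t i j, i != j -> tnth t i = tnth t j -> f t = 0.

Definition elift (U : lmodType K) (f : n.-tuple V -> U) : ext -> U :=
  plift (S := ext_rel) f.
HB.instance Definition _ U f := GRing.Linear.on (@elift U f).

Lemma elift_wedge (U : lmodType K) (f : n.-tuple V -> U) :
  multilinear f -> alternating f -> forall t : n.-tuple V, elift f (wedge t) = f t.
Proof.
move=> fl fa t; rewrite /elift /wedge plift_gen => [|r].
  by congr f; apply: eq_from_tnth => i; rewrite tnth_mktuple (tnth_nth 0).
case=> [[u [i [a [v [w ->]]]]]|[u [i [j [ij uij ->]]]]].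
  by rewrite !linearB linearZ /= !liftU /= !scale1r fl [_ *: _ + _]addrC addrK subrr.
by rewrite liftU scale1r (fa _ i j).
Qed.
End Def.
End Exterior.
Arguments wedge {K} n {V} s.

HB.mixin Record isLieAlgebra (K : fieldType) g of GRing.Lmodule K g := {
  lie : g -> g -> g;
  lieDl : forall (a : K) x y z, lie (a *: x + y) z = a *: lie x z + lie y z;
  lieDr : forall (a : K) x y z, lie x (a *: y + z) = a *: lie x y + lie x z;
  liexx : forall x, lie x x = 0;
  lie_jacobi : forall x y z,
    lie x (lie y z) + lie y (lie z x) + lie z (lie x y) = 0
}.
#[short(type="lieAlgType")]
HB.structure Definition LieAlgebra (K : fieldType) :=
  {g of isLieAlgebra K g & GRing.Lmodule K g}.

Section LieProd.
Variables (K : fieldType) (g h : lieAlgType K).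

Definition lie_prod (x y : g * h) : g * h := (lie x.1 y.1, lie x.2 y.2).

Fact lie_prodDl (a : K) x y z :
  lie_prod (a *: x + y) z = a *: lie_prod x z + lie_prod y z.
Proof. by rewrite /lie_prod /= !lieDl. Qed.
Fact lie_prodDr (a : K) x y z :
  lie_prod x (a *: y + z) = a *: lie_prod x y + lie_prod x z.
Proof. by rewrite /lie_prod /= !lieDr. Qed.
Fact lie_prodxx x : lie_prod x x = 0.
Proof. by rewrite /lie_prod /= !liexx. Qed.
Fact lie_prod_jacobi x y z :
  lie_prod x (lie_prod y z) + lie_prod y (lie_prod z x) +
  lie_prod z (lie_prod x y) = 0.
Proof. by congr pair; apply: lie_jacobi. Qed.

HB.instance Definition _ := isLieAlgebra.Build K (g * h)%type
  lie_prodDl lie_prodDr lie_prodxx lie_prod_jacobi.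
End LieProd.

HB.mixin Record isCocommCoalgebra (K : fieldType) C of GRing.Lmodule K C := {
  comul : {linear C -> tensor C C};
  counit : {scalar C};
  comulA : forall x : C,
    tlift (fun y z => tlift (fun y1 y2 => tens y1 (tens y2 z)) (comul y)) (comul x) =
    tlift (fun y z => tens y (comul z)) (comul x);
  counitl : forall x : C, tlift (fun y z => counit y *: z) (comul x) = x;
  counitr : forall x : C, tlift (fun y z => counit z *: y) (comul x) = x;
  comulC : forall x : C, tlift (fun y z => tens z y) (comul x) = comul x
}.
#[short(type="cocommCoalgType")]
HB.structure Definition CocommCoalgebra (K : fieldType) :=
  {C of isCocommCoalgebra K C & GRing.Lmodule K C}.

Section Sweedler.
Variables (K : fieldType) (C : cocommCoalgType K) (U : lmodType K).

(* sum f(x_(1), x_(2)), for a bilinear f *)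
Definition sweedler (f : C -> C -> U) (x : C) : U := tlift f (comul x).

(* sum f [:: x_(1); ..; x_(n)] for a multilinear f; the recursion ends in degree 0
   with the counit, which gives f [:: x] for n = 1 by the counit axiom. *)
Fixpoint sweedlern n (f : seq C -> U) (x : C) : U :=
  if n is n'.+1 then sweedler (fun y z => sweedlern n' (fun s => f (y :: s)) z) x
  else counit x *: f [::].
End Sweedler.

Record measuring (K : fieldType) (g g' : lieAlgType K) (C : cocommCoalgType K)
    (Psi : C -> {linear g -> g'}) : Prop := {
  measuring_linear : forall (a : K) x y u, Psi (a *: x + y) u = a *: Psi x u + Psi y u;
  measuring_lie : forall x u v,
    Psi x (lie u v) = sweedler (fun y z => lie (Psi y u) (Psi z v)) x
}.

(* bd \o bd = 0 is not recorded: homology below is the space of cycles modulo the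
   boundaries lying in it, which is the usual quotient as soon as bd \o bd = 0. *)
Record chain_complex (K : fieldType) := ChainComplex {
  chain :> nat -> lmodType K;
  bd : forall n, {linear chain n.+1 -> chain n}
}.

Section Homology.
Variables (K : fieldType) (C : chain_complex K).

Definition is_cycle n : {pred C n} :=
  match n return pred (C n) with
  | 0 => xpredT
  | n'.+1 => fun z => bd C n' z == 0
  end.

Fact is_cycle_closed n : submod_closed (@is_cycle n).
Proof.
case: n => [|n]; first by split.
split; first by rewrite unfold_in /= raddf0.
move=> a u v; rewrite !unfold_in /= => /eqP u0 /eqP v0.
by rewrite linearP /= u0 v0 scaler0 addr0.
Qed.
HB.instance Definition _ n :=
  GRing.isSubmodClosed.Build K (C n) (@is_cycle n) (@is_cycle_closed n).

Definition cycles n : Type := {z : C n | is_cycle z}.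
HB.instance Definition _ n := SubChoice.on (cycles n).
HB.instance Definition _ n := [SubChoice_isSubLmodule of cycles n by <:].

Definition boundary n : set (cycles n) := [set z | exists y, val z = bd C n y].

Definition homology n : Type := lquot (@boundary n).
HB.instance Definition _ n := GRing.Lmodule.on (homology n).

(* Meant for cycles v; the class is 0 otherwise. *)
Definition hclass n (v : C n) : homology n :=
  lpi (@boundary n) (insubd (0 : cycles n) v).

Definition hrep n (h : homology n) : C n := val (repr (h : lquot (@boundary n))).
End Homology.

(* The map induced by f, computed on a representative; meant for chain maps f. *)
Definition hmap (K : fieldType) (C D : chain_complex K) (f : forall n, C n -> D n)
    n (h : homology C n) : homology D n := hclass (f n (hrep h)).

Definition bidegree n : Type := {pq : nat * nat | pq.1 + pq.2 == n}%N.
HB.instance Definition _ n := SubChoice.on (bidegree n).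

(* Degree n part of the tensor product: the direct sum of the V p (x) W q, p + q = n. *)
Definition gtensor (K : fieldType) (V W : nat -> lmodType K) n : Type :=
  dsum (fun i : bidegree n => tensor (V (val i).1) (W (val i).2)).
HB.instance Definition _ K V W n := GRing.Lmodule.on (@gtensor K V W n).

Section GradedTensor.
Variable K : fieldType.

Definition ginj (V W : nat -> lmodType K) n p q (e : (p + q == n)%N)
    (t : tensor (V p) (W q)) : gtensor V W n :=
  dinj (V := fun i : bidegree n => tensor (V (val i).1) (W (val i).2))
    (i := exist _ (p, q) e) t.

Definition glift (V W : nat -> lmodType K) n (U : lmodType K)
    (f : forall p q, (p + q == n)%N -> V p -> W q -> U) : gtensor V W n -> U :=
  dlift (fun i : bidegree n => tlift (f (val i).1 (val i).2 (valP i))).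
HB.instance Definition _ V W n U f := GRing.Linear.on (@glift V W n U f).

Lemma glift_inj (V W : nat -> lmodType K) n (U : lmodType K)
    (f : forall p q, (p + q == n)%N -> V p -> W q -> U) :
  (forall p q e a v v' w, f p q e (a *: v + v') w = a *: f p q e v w + f p q e v' w) ->
  (forall p q e a v w w', f p q e v (a *: w + w') = a *: f p q e v w + f p q e v w') ->
  forall p q e v w, glift f (ginj e (tens v w)) = f p q e v w.
Proof.
move=> fl fr p q e v w; rewrite /glift /ginj dlift_inj => [|i]; last exact: linearP.
rewrite tlift_tens /=; first by congr f; exact: bool_irrelevance.
  by move=> *; rewrite fl.
by move=> *; rewrite fr.
Qed.

Definition gmap (V V' W W' : nat -> lmodType K) (f : forall n, V n -> V' n)
    (g : forall n, W n -> W' n) n : gtensor V W n -> gtensor V' W' n :=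
  glift (fun p q e v w => ginj e (tens (f p v) (g q w))).

Section TensorComplex.
Variables C D : chain_complex K.

Fact bidegree_r p q n : (p + q.+1 == n.+1)%N -> (p + q == n)%N.
Proof. by rewrite addnS. Qed.

Definition tbdl n p q : (p + q == n.+1)%N -> C p -> D q -> gtensor C D n :=
  match p return (p + q == n.+1)%N -> C p -> D q -> gtensor C D n with
  | 0 => fun _ _ _ => 0
  | p'.+1 => fun e v w => ginj (e : (p' + q == n)%N) (tens (bd C p' v) w)
  end.

Definition tbdr n p q : (p + q == n.+1)%N -> C p -> D q -> gtensor C D n :=
  match q return (p + q == n.+1)%N -> C p -> D q -> gtensor C D n with
  | 0 => fun _ _ _ => 0
  | q'.+1 => fun e v w => (-1) ^+ p *: ginj (bidegree_r e) (tens v (bd D q' w))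
  end.

(* d (v (x) w) = dv (x) w + (-1)^p v (x) dw for v in degree p *)
Definition tensor_complex : chain_complex K :=
  ChainComplex (fun n => glift (fun p q e v w => tbdl e v w + tbdr e v w)
    : {linear gtensor C D n.+1 -> gtensor C D n}).

(* [u] (x) [v] |-> [u (x) v] *)
Definition kunneth n :
    gtensor (homology C) (homology D) n -> homology tensor_complex n :=
  glift (fun p q e h k =>
    hclass (C := tensor_complex) (n := n) (ginj e (tens (hrep h) (hrep k)))).
End TensorComplex.
End GradedTensor.

Section ChevalleyEilenberg.
Variable K : fieldType.

(* s without its entries of index i and j *)
Definition skip2 (V : lmodType K) i j (s : seq V) : seq V :=
  [seq s`_k | k <- iota 0 (size s) & (k != i) && (k != j)].

(* Indices start at 0 rather than 1, which leaves the parity of i + j unchanged. *)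
Definition ce_bd (g : lieAlgType K) n : ext n.+1 g -> ext n g :=
  elift (fun t : n.+1.-tuple g =>
    \sum_(i < n.+1) \sum_(j < n.+1 | (i < j)%N)
      (-1) ^+ (i + j + 1) *: wedge n (lie t`_i t`_j :: skip2 i j t)).
HB.instance Definition _ g n := GRing.Linear.on (@ce_bd g n).

Definition ce (g : lieAlgType K) : chain_complex K := ChainComplex (@ce_bd g).

Definition ext_map (V W : lmodType K) (f : V -> W) n : ext n V -> ext n W :=
  elift (fun t : n.-tuple V => wedge n (map f t)).

(* The canonical isomorphism, u (x) v |-> (u, 0) /\ (0, v) on exterior powers. *)
Definition ext_sum (g : lieAlgType K) n :
    gtensor (ce g) (ce g) n -> ce (g * g)%type n :=
  glift (fun p q e => fun (u : ext p g) (v : ext q g) =>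
    elift (fun s : p.-tuple g => elift (fun t : q.-tuple g =>
      wedge n ([seq (a, 0) | a <- s] ++ [seq (0, b) | b <- t])) v) u).

(* The inverse of f when f is bijective (an arbitrary choice of preimages otherwise). *)
Definition inv_of (A : Type) (V : lmodType K) (f : V -> A) (y : A) : V :=
  xget 0 [set v | f v = y].

(* H(g) -> H(g (+) g) -> H(CE(g) (x) CE(g)) -> H(g) (x) H(g), in degree n: the diagonal,
   then the inverse of ext_sum, then the inverse of the Kunneth isomorphism. *)
Definition homology_coprod (g : lieAlgType K) n (h : homology (ce g) n) :
    gtensor (homology (ce g)) (homology (ce g)) n :=
  inv_of (@kunneth K (ce g) (ce g) n)
    (hmap (C := ce (g * g)%type) (D := tensor_complex (ce g) (ce g))
       (fun m => inv_of (@ext_sum g m))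
       (hmap (C := ce g) (D := ce (g * g)%type)
         (fun m => ext_map (fun a : g => (a, a)) (n := m)) h)).

Definition ce_measuring (g g' : lieAlgType K) (C : cocommCoalgType K)
    (Psi : C -> {linear g -> g'}) (x : C) n : ce g n -> ce g' n :=
  elift (fun t : n.-tuple g => sweedlern n (fun s : seq C =>
    wedge n [seq Psi ya.1 ya.2 | ya <- zip s t]) x).

Definition homology_measuring (g g' : lieAlgType K) (C : cocommCoalgType K)
    (Psi : C -> {linear g -> g'}) (x : C) n :
    homology (ce g) n -> homology (ce g') n :=
  @hmap K (ce g) (ce g') (ce_measuring Psi x) n.
End ChevalleyEilenberg.

(* The formulas defining ce_bd and ce_measuring respect the relations of the exterior
   powers, so that these maps are given by them on wedges: ce_bdE and ce_measuringE. *)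

Lemma lpi_rel (K : fieldType) (V : lmodType K) (S : set V) r : S r -> lpi S r = 0.
Proof.
move=> Sr; rewrite -(raddf0 (lpi S)); apply/lpiP; rewrite subr0.
by apply/asboolP => U _; apply.
Qed.

Section Wedge.
Variables (K : fieldType) (V : lmodType K) (n : nat).

Lemma wedge_tuple (t : n.-tuple V) : wedge n t = gen (@ext_rel K n V) t.
Proof. by congr gen; apply: eq_from_tnth => i; rewrite tnth_mktuple (tnth_nth 0). Qed.

Lemma wedge_cons_lin (s1 s2 : seq V) a (u v : V) : (size s1 < n)%N ->
  wedge n (s1 ++ (a *: u + v) :: s2) =
  a *: wedge n (s1 ++ u :: s2) + wedge n (s1 ++ v :: s2).
Proof.
move=> s1n; pose t := [tuple (s1 ++ 0 :: s2)`_i | i < n].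
pose i := Ordinal s1n.
have E x : wedge n (s1 ++ x :: s2) = gen (@ext_rel K n V) (upd t i x).
  congr gen; apply: eq_from_tnth => j; rewrite !tnth_mktuple !nth_cat.
  have -> : (j == i) = (j == size s1 :> nat) by [].
  case: ltngtP => // [|->]; last by rewrite subnn.
  by move=> lt; rewrite -(subnSK lt).
rewrite !E; apply/eqP; rewrite -subr_eq0 opprD addrA; apply/eqP.
rewrite /gen -linearZ -!raddfB; apply: lpi_rel; left.
by exists t, i, a, u, v.
Qed.

Lemma wedge_dup (s1 s2 s3 : seq V) (u : V) : (size s1 + size s2 < n.-1)%N ->
  wedge n (s1 ++ u :: s2 ++ u :: s3) = 0.
Proof.
move=> sn; apply: lpi_rel; right.
have i1 : (size s1 < n)%N by lia.
have i2 : (size s1 + (size s2).+1 < n)%N by lia.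
set t := [tuple _ | _ < _]; exists t, (Ordinal i1), (Ordinal i2).
split=> //; first by rewrite -val_eqE /=; lia.
rewrite !tnth_mktuple /= !nth_cat ltnn subnn /=.
have -> : (size s1 + (size s2).+1 < size s1)%N = false by lia.
have -> : (size s1 + (size s2).+1 - size s1 = (size s2).+1)%N by lia.
by rewrite /= nth_cat ltnn subnn.
Qed.

Lemma wedge_swap (s1 s2 : seq V) (u v : V) : ((size s1).+1 < n)%N ->
  wedge n (s1 ++ u :: v :: s2) = - wedge n (s1 ++ v :: u :: s2).
Proof.
move=> sn; have d x : wedge n (s1 ++ x :: x :: s2) = 0.
  by apply: (@wedge_dup _ [::]); rewrite /=; lia.
have := d (1 *: u + v); rewrite wedge_cons_lin; last by lia.
rewrite -!(cat_rcons _ s1) !wedge_cons_lin ?size_rcons; [|lia..].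
rewrite !cat_rcons !d !scale1r add0r addr0 => /eqP.
by rewrite addr_eq0 => /eqP.
Qed.

Lemma wedge_move (s1 s2 s3 : seq V) (u : V) : (size s1 + size s2 < n)%N ->
  wedge n (s1 ++ u :: s2 ++ s3) = (-1) ^+ size s2 *: wedge n (s1 ++ s2 ++ u :: s3).
Proof.
elim: s2 s1 => [|v s2 IH] s1 /= sn; first by rewrite scale1r.
rewrite wedge_swap; last by lia.
rewrite -cat_rcons IH ?size_rcons; last by lia.
by rewrite cat_rcons exprS -scalerA scaleN1r.
Qed.

End Wedge.

Section CE.
Variables (K : fieldType) (g : lieAlgType K).

Lemma lieN (x y : g) : lie x y = - lie y x.
Proof.
have := liexx (1 *: x + y); rewrite lieDl !lieDr !liexx !scale1r add0r addr0.
by move/eqP; rewrite addr_eq0 => /eqP.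
Qed.

Lemma skip2C (V : lmodType K) i j (s : seq V) : skip2 i j s = skip2 j i s.
Proof. by rewrite /skip2; congr map; apply: eq_filter => k; rewrite andbC. Qed.

Lemma nth_upd n (V : lmodType K) (t : n.-tuple V) (i : 'I_n) v k :
  (upd t i v)`_k = if k == i then v else t`_k.
Proof.
have [kn|kn] := ltnP k n; last first.
  rewrite !nth_default ?size_tuple //.
  by case: eqP => // E; move: (ltn_ord i); lia.
rewrite -(tnth_nth 0 (upd t i v) (Ordinal kn)) tnth_mktuple.
by rewrite -val_eqE /=; case: eqP => // _; rewrite (tnth_nth 0).
Qed.

Lemma skip2_cat (V : lmodType K) (f : nat -> V) (P : pred nat) k m :
  (k < m)%N -> P k ->
  [seq f i | i <- iota 0 m & P i] =
  [seq f i | i <- iota 0 k & P i] ++ f k :: [seq f i | i <- iota k.+1 (m - k.+1) & P i].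
Proof.
move=> km Pk; have {1}-> : m = (k + (m - k.+1).+1)%N by lia.
by rewrite iotaD filter_cat map_cat /= Pk.
Qed.

Lemma iota_skip m k l : (k < l < m)%N ->
  iota 0 m = iota 0 k ++ k :: iota k.+1 (l - k.+1) ++ l :: iota l.+1 (m - l.+1).
Proof.
move=> /andP[kl lm]; have {1}-> : m = (k + (1 + ((l - k.+1) + (m - l.+1).+1)))%N by lia.
rewrite iotaD add0n; congr cat; rewrite iotaD /= addn1; congr cons.
rewrite iotaD /=; congr cat.
by have -> : (k.+1 + (l - k.+1) = l)%N by lia.
Qed.


Lemma count_skip m i j : (i < j)%N -> (j < m)%N ->
  count (fun z : nat => (z != i) && (z != j)) (iota 0 m) = (m - 2)%N.
Proof.
move=> ij jm; have := count_predC (fun z : nat => (z != i) && (z != j)) (iota 0 m).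
have -> : count (predC (fun z : nat => (z != i) && (z != j))) (iota 0 m) = 2%N.
  rewrite (@iota_skip m i j) ?ij //.
  rewrite count_cat /= count_cat /= !eqxx andbF /=.
  rewrite !(@eq_in_count _ _ pred0) ?count_pred0 //; move=> y; rewrite mem_iota /=; lia.
rewrite size_iota; lia.
Qed.

Lemma term_lin n (t : n.+1.-tuple g) (k i j : 'I_n.+1) a u v : (i < j)%N ->
  let F (t : n.+1.-tuple g) := wedge n (lie t`_i t`_j :: skip2 i j t) in
  F (upd t k (a *: u + v)) = a *: F (upd t k u) + F (upd t k v).
Proof.
move=> ij F; rewrite /F !nth_upd /skip2 !size_tuple.
have E (P : pred nat) l m x : (forall y, y \in iota l m -> P y -> y != k) ->
    [seq (upd t k x)`_y | y <- iota l m & P y] = [seq t`_y | y <- iota l m & P y].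
  move=> H; apply/eq_in_map => y; rewrite mem_filter => /andP[Py yl].
  by rewrite nth_upd (negbTE (H _ yl Py)).
have n0 : (0 < n)%N by move: (ltn_ord j); lia.
case: eqP => [ik|ik].
  rewrite !E; try by move=> y _; lia.
  have -> : (j == k :> nat) = false by lia.
  by rewrite lieDl; exact: (wedge_cons_lin (s1 := [::])).
case: eqP => [jk|jk].
  rewrite !E; try by move=> y _; lia.
  by rewrite lieDr; exact: (wedge_cons_lin (s1 := [::])).
have P : ((k : nat) != i) && ((k : nat) != j) by lia.
rewrite !(skip2_cat _ (ltn_ord k) P) !nth_upd eqxx.
rewrite !E; try by move=> y; rewrite mem_iota; lia.
rewrite -!cat_cons wedge_cons_lin //= size_map size_filter.
have := count_skip ij (ltn_ord j).
have E2 : n.+1 = (k + (n.+1 - k.+1).+1)%N by move: (ltn_ord k); lia.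
have -> : iota 0 n.+1 = iota 0 (k + (n.+1 - k.+1).+1)%N by rewrite -E2.
rewrite iotaD count_cat /= add0n P; lia.
Qed.

Lemma ce_bdE n (t : n.+1.-tuple g) : ce_bd (wedge n.+1 t) =
  \sum_(i < n.+1) \sum_(j < n.+1 | (i < j)%N)
      (-1) ^+ (i + j + 1) *: wedge n (lie t`_i t`_j :: skip2 i j t).
Proof.
rewrite /ce_bd elift_wedge // => [{}t k a u v|{}t k l].
  rewrite scaler_sumr -big_split; apply: eq_bigr => i _ /=.
  rewrite scaler_sumr -big_split; apply: eq_bigr => j ij /=.
  by rewrite (@term_lin n t k i j a u v ij) scalerDr !scalerA mulrC.
wlog kl : k l / (k < l)%N.
  move=> W kl tkl; case: (ltngtP k l) => H.
  - exact: (W k l).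
  - by apply: (W l k) => //; rewrite eq_sym.
  - by move: kl; rewrite (val_inj H) eqxx.
move=> nkl; rewrite !(tnth_nth 0) => tkl.
pose c (i j : nat) := (-1) ^+ (i + j + 1) *: wedge n (lie t`_i t`_j :: skip2 i j t).
pose A (i j : nat) := if (i < j)%N then c i j else 0.
under eq_bigr do rewrite big_mkcond.
rewrite -[LHS]/(\sum_(i < n.+1) \sum_(j < n.+1) A i j).
have kn := ltn_ord k; have ln := ltn_ord l.
have A0 (i j : 'I_n.+1) : i != k -> i != l -> j != k -> j != l -> A i j = 0.
  rewrite -!val_eqE /= => ik il jk jl; rewrite /A; case: ifP => // ij; rewrite /c /skip2 size_tuple.
  rewrite (@iota_skip n.+1 k l) ?kl //.
  rewrite filter_cat map_cat /= (eq_sym (k : nat)) ik (eq_sym (k : nat)) jk /=.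
  rewrite filter_cat map_cat /= (eq_sym (l : nat)) il (eq_sym (l : nat)) jl /= -tkl.
  rewrite -cat_cons wedge_dup ?scaler0 //= !size_map !size_filter.
  have := count_skip ij (ltn_ord j).
  rewrite (@iota_skip n.+1 k l) ?kl // count_cat /= count_cat /=.
  rewrite (eq_sym (k : nat)) ik (eq_sym (k : nat)) jk (eq_sym (l : nat)) il (eq_sym (l : nat)) jl /=.
  lia.
have w0 s : (0 < n)%N -> wedge n ((0 : g) :: s) = 0.
  move=> n0; have := @wedge_cons_lin _ g n [::] s (-1) 0 0 n0.
  by rewrite scaler0 addr0 /= scaleN1r addNr.
have Akl : A k l = 0.
  by rewrite /A kl /c -tkl liexx w0 ?scaler0 //; lia.
have Aii (i : 'I_n.+1) : A i i = 0 by rewrite /A ltnn.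
have Alk : A l k = 0 by rewrite /A ltnNge ltnW.
have lk' : l != k by rewrite eq_sym.
have B (m : 'I_n.+1) : m != k -> m != l ->
    A m k + A k m + (A m l + A l m) = 0.
  rewrite -!val_eqE /= => mk ml.
  have mn := ltn_ord m.
  have B1 (p : 'I_n.+1) : m != p :> nat -> A m p + A p m =
      (-1) ^+ ((p < m) + m + p + 1) *: wedge n (lie t`_m t`_p :: skip2 m p t).
    rewrite /A /c; case: ltngtP => // mp _.
      by rewrite addr0 add0n.
    rewrite add0r lieN skip2C -scaleN1r.
    have /(@wedge_cons_lin _ g n [::] (skip2 m p t) (-1) (lie t`_m t`_p) 0) : (0 < n)%N by lia.
    rewrite /= addr0 w0; last by lia.
    rewrite addr0 => ->; rewrite scalerA -exprSr; congr (_ ^+ _ *: _); lia.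
  rewrite !B1 // -tkl /skip2 size_tuple (@iota_skip n.+1 k l) ?kl //
    !filter_cat !map_cat /=.
  have kl1 : (k != l :> nat) by lia.
  have lk1 : (l != k :> nat) by lia.
  rewrite !eqxx !andbF (eq_sym (k : nat)) mk kl1 /=.
  rewrite !filter_cat /= !eqxx !andbF (eq_sym (l : nat)) ml lk1 /= !map_cat /=.
  have fk a r (P : pred nat) : (forall x : nat, x \in iota a r -> P x) ->
      [seq t`_x | x <- iota a r & (x != m :> nat) && P x] =
      [seq t`_x | x <- iota a r & x != m :> nat].
    by move=> Px; congr map; apply: eq_in_filter => x /Px ->; rewrite andbT.
  rewrite !fk; try by move=> x; rewrite mem_iota; lia.
  have e q r : (count (fun z : nat => z != m :> nat) (iota q r) = r - (q <= m < q + r))%N.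
    have := count_predC (fun z : nat => z != m :> nat) (iota q r).
    have -> : count (predC (fun z : nat => z != m :> nat)) (iota q r) = (q <= m < q + r)%N.
      rewrite -mem_iota -count_uniq_mem ?iota_uniq //.
      by apply: eq_count => z /=; rewrite negbK.
    rewrite size_iota; lia.
  set S1 := map _ _; set S2 := map _ (filter _ (iota k.+1 _)); set S3 := map _ _.
  rewrite -tkl /=.
  rewrite -(cat_cons _ S1 (_ :: _)) [X in _ + _ *: X]wedge_move; last first.
    rewrite /= /S1 /S2 !size_map !size_filter.
    rewrite !e; lia.
  have s2 : size S2 = (l - k.+1 - (k < m < l))%N.
    rewrite /S2 size_map size_filter e; lia.
  rewrite /= scalerA -exprD -scalerDl s2 -signr_odd -[X in _ + X]signr_odd.
  set a := odd _; set b := odd _.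
  have -> : a = ~~ b by rewrite /a /b; lia.
  by rewrite signrN addNr scale0r.
pose Q (m : 'I_n.+1) := (m != k) && (m != l).
have split2 (F : 'I_n.+1 -> ext n g) : \sum_i F i = F k + (F l + \sum_(i | Q i) F i).
  by rewrite (bigD1 k) //= (bigD1 l).
rewrite split2 split2 (split2 (A l)) Aii Akl Alk Aii !add0r.
rewrite -big_split -big_split /=; apply: big1 => m /andP[mk ml].
rewrite split2 [X in _ + (_ + (_ + (_ + X)))]big1; last by move=> j /andP[jk jl]; exact: A0.
rewrite addr0 -[RHS](B m mk ml) [A m k + A k m]addrC -!addrA; congr (_ + _).
by rewrite addrCA; congr (_ + _); rewrite addrC.
Qed.
End CE.

Definition bil (K : fieldType) (V W U : lmodType K) (f : V -> W -> U) :=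
  (forall a v v' w, f (a *: v + v') w = a *: f v w + f v' w) /\
  (forall a v w w', f v (a *: w + w') = a *: f v w + f v w').

Section TL.
Variables (K : fieldType) (V W U : lmodType K).
Lemma tliftE (f : V -> W -> U) v w : bil f -> tlift f (tens v w) = f v w.
Proof. by case=> *; apply: tlift_tens. Qed.

Lemma tens_ind (P : tensor V W -> Prop) :
  (forall a v w t, P t -> P (a *: tens v w + t)) -> P 0 -> forall t, P t.
Proof. by move=> PS P0; apply: pres_ind => // a [v w] t; apply: PS. Qed.

Lemma tens_bil : @bil K V W (tensor V W) (@tens K V W).
Proof.
split=> a v v' w; apply/eqP; rewrite -subr_eq0 opprD addrA; apply/eqP;
  rewrite /tens /gen -linearZ -!raddfB; apply: lpi_rel; [left|right];
  by do 4 eexists.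
Qed.

Lemma tlift_comb (f g : V -> W -> U) a t : bil f -> bil g ->
  tlift (fun v w => a *: f v w + g v w) t = a *: tlift f t + tlift g t.
Proof.
move=> bf bg.
have b : bil (fun v w => a *: f v w + g v w).
  case: bf bg => [f1 f2] [g1 g2]; split=> c x y z.
    by rewrite f1 g1 !scalerDr !scalerA [a * c]mulrC addrACA.
  by rewrite f2 g2 !scalerDr !scalerA [a * c]mulrC addrACA.
elim/tens_ind: t => [c v w t IH|]; last by rewrite !raddf0 addr0.
rewrite !linearP /= IH !tliftE // !scalerDr !scalerA.
by rewrite addrACA.
Qed.

End TL.
Section TL2.
Variables (K : fieldType) (V W U : lmodType K).
Lemma lin_tlift (U' : lmodType K) (H : {linear U -> U'}) (f : V -> W -> U) t : bil f ->
  H (tlift f t) = tlift (fun v w => H (f v w)) t.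
Proof.
move=> bf; have b : bil (fun v w => H (f v w)).
  by case: bf => f1 f2; split=> *; rewrite ?f1 ?f2 linearP.
elim/tens_ind: t => [c v w t IH|]; last by rewrite !raddf0.
by rewrite !linearP /= IH (tliftE v w bf) (tliftE v w b).
Qed.
End TL2.

Section SW.
Variables (K : fieldType) (C : cocommCoalgType K) (U : lmodType K).
Implicit Types f : seq C -> U.

Definition mlin n f := forall (s1 s2 : seq C) a u v, (size s1 + size s2).+1 = n ->
  f (s1 ++ (a *: u + v) :: s2) = a *: f (s1 ++ u :: s2) + f (s1 ++ v :: s2).

Lemma mlin_cons n f y : mlin n.+1 f -> mlin n (fun s => f (y :: s)).
Proof. by move=> mf s1 s2 a u v E; apply: (mf (y :: s1)); rewrite /= addSn E. Qed.

Lemma mlin_cons2 n f y z : mlin n.+2 f -> mlin n (fun s => f [:: y, z & s]).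
Proof. by move=> mf; apply: (@mlin_cons n (fun s => f (y :: s))); apply: mlin_cons. Qed.

Lemma sw_lin n f : linear (sweedlern n f).
Proof.
case: n => [|n] a x y; rewrite /= /sweedler.
  by rewrite linearP /= scalerDl scalerA.
by rewrite !linearP.
Qed.

Lemma sw_ext n f f' x : (forall s, size s = n -> f s = f' s) ->
  sweedlern n f x = sweedlern n f' x.
Proof.
elim: n f f' x => [|n IH] f f' x E /=; first by rewrite E.
congr tlift; apply/funext => y; apply/funext => z; apply: IH => s sn.
by apply: E; rewrite /= sn.
Qed.

Lemma sw_comb_bil n :
  (forall f f' a x, mlin n f -> mlin n f' ->
  sweedlern n (fun s => a *: f s + f' s) x = a *: sweedlern n f x + sweedlern n f' x)
  /\ (forall f, mlin n.+1 f -> bil (fun y z => sweedlern n (fun s => f (y :: s)) z)).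
Proof.
elim: n => [|n [IH1 IH2]].
- have H f f' a x : mlin 0 f -> mlin 0 f' ->
    sweedlern 0 (fun s => a *: f s + f' s) x = a *: sweedlern 0 f x + sweedlern 0 f' x.
    by move=> _ _ /=; rewrite scalerDr !scalerA mulrC.
  split=> // f mf; split=> [a y y' z|a y z z']; last exact: sw_lin.
  rewrite -H; [|exact: mlin_cons..].
  by apply: sw_ext => s sn; apply: (mf [::]); rewrite /= sn.
have H f f' a x : mlin n.+1 f -> mlin n.+1 f' ->
  sweedlern n.+1 (fun s => a *: f s + f' s) x =
  a *: sweedlern n.+1 f x + sweedlern n.+1 f' x.
  move=> mf mf' /=.
  rewrite /sweedler -tlift_comb; [|exact: IH2..].
  congr tlift; apply/funext => y; apply/funext => z.
  by apply: IH1; apply: mlin_cons.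
split=> // f mf; split=> [a y y' z|a y z z']; last exact: (@sw_lin n.+1).
rewrite -H; [|exact: mlin_cons..].
by apply: sw_ext => s sn; apply: (mf [::]); rewrite /= sn.
Qed.
Definition sw_comb n := (sw_comb_bil n).1.
Definition sw_bil n := (sw_comb_bil n).2.

Lemma sw_tri (h : C -> C -> C -> U) x :
  (forall y, bil (h y)) -> (forall z, bil (fun y y' => h y y' z)) ->
  tlift (fun y z => tlift (fun y' z' => h y y' z') (comul z)) (comul x) =
  tlift (fun y z => tlift (fun y1 y2 => h y1 y2 z) (comul y)) (comul x).
Proof.
move=> b1 b2.
have bH : bil (fun y w => tlift (h y) w).
  split=> [a y y' w|a y w w']; last exact: linearP.
  rewrite -tlift_comb //; congr tlift; apply/funext => u; apply/funext => v.
  by case: (b2 v) => -> _.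
have [t1 t2] := @tens_bil K C C.
have [T1 T2] := @tens_bil K C (tensor C C).
pose H : {linear tensor C (tensor C C) -> U} := tlift (fun y w => tlift (h y) w).
have := congr1 H (comulA x).
have bt (z : C) : bil (fun y1 y2 : C => tens y1 (tens y2 z)).
  by split=> *; rewrite ?T1 // t1 T2.
rewrite (lin_tlift H) ?(lin_tlift H); last first.
- split=> [a y y' z|a y z z']; first by rewrite !linearP.
  rewrite -tlift_comb //; congr tlift; apply/funext => u; apply/funext => v.
  by rewrite t2 T2.
- by split=> *; rewrite ?T1 // linearP T2.
have -> : (fun v w => H (tens v (comul w))) = (fun v w => tlift (h v) (comul w)).
  by apply/funext=> v; apply/funext=> w; rewrite /H /= tliftE.
move=> <-; congr tlift; apply/funext=> v; apply/funext=> w.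
rewrite (lin_tlift H) //; congr tlift; apply/funext=> y; apply/funext=> z.
by rewrite /H /= !tliftE.
Qed.

Definition adj k (s : seq C) := take k s ++ (nth 0 s k.+1 :: nth 0 s k :: drop k.+2 s).

Lemma tlift_swap (h : C -> C -> U) x : bil h ->
  tlift (fun y z => h z y) (comul x) = tlift h (comul x).
Proof.
move=> bh; have [t1 t2] := @tens_bil K C C.
rewrite -[in RHS]comulC (lin_tlift (tlift h)).
  by congr tlift; apply/funext => y; apply/funext => z; rewrite /= tliftE.
by split=> *; rewrite ?t1 ?t2.
Qed.

Lemma sw_adj n k f x : (k.+1 < n)%N -> mlin n f ->
  sweedlern n (fun s => f (adj k s)) x = sweedlern n f x.
Proof.
elim: k n f x => [|k IH] [|n] f x //= kn mf.
  case: n kn mf => // n _ mf; rewrite /= /sweedler.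
  have b1 y : bil (fun y' z' => sweedlern n (fun s => f [:: y, y' & s]) z').
    by apply: (@sw_bil n (fun s => f (y :: s))); apply: mlin_cons.
  have b2 z : bil (fun y y' => sweedlern n (fun s => f [:: y, y' & s]) z).
    split=> [a y y' w|a y w w'].
      rewrite -(@sw_comb n (fun s => f [:: y, w & s]) (fun s => f [:: y', w & s])); try exact: mlin_cons2.
      by apply: sw_ext => s sn; apply: (mf [::]); rewrite /= sn.
    rewrite -(@sw_comb n (fun s => f [:: y, w & s]) (fun s => f [:: y, w' & s])); try exact: mlin_cons2.
    by apply: sw_ext => s sn; apply: (mf [:: y]); rewrite /= sn.
  have E y y' z : sweedlern n (fun s => f (adj 0 [:: y, y' & s])) z =
      sweedlern n (fun s => f [:: y', y & s]) z.
    by apply: sw_ext => s _; rewrite /adj /= drop0.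
  rewrite (@sw_tri (fun y y' z => sweedlern n (fun s => f [:: y, y' & s]) z)) //.
  rewrite (@sw_tri (fun y y' z => sweedlern n (fun s => f (adj 0 [:: y, y' & s])) z)).
  - congr tlift; apply/funext => y; apply/funext => z.
    rewrite -(tlift_swap _ (b2 z)); congr tlift; apply/funext=> u; apply/funext=> v.
    by apply: sw_ext => s _; rewrite /adj /= drop0.
  - move=> y; split=> [a u v w|a u v w]; last exact: sw_lin.
    by have [b _] := b2 w; rewrite !E b.
  - by move=> z; have [b b'] := b2 z; split=> *; rewrite !E ?b ?b'.
rewrite /sweedler; congr tlift; apply/funext => y; apply/funext => z.
by apply: (IH n (fun s => f (y :: s))) => //; apply: mlin_cons.
Qed.
End SW.

Section Meas.
Variables (K : fieldType) (g g' : lieAlgType K) (C : cocommCoalgType K).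
Variables (Psi : C -> {linear g -> g'}) (mP : measuring Psi) (n : nat).
Variable K2 : (2%:R : K) != 0.

Let F (t : seq g) (s : seq C) := wedge n [seq Psi ya.1 ya.2 | ya <- zip s t].

Let F_mlin t : size t = n -> mlin n (F t).
Proof.
move=> tn s1 s2 a u v E; rewrite /F.
have i : (size s1 < size t)%N by lia.
rewrite -(cat_take_drop (size s1) t) (drop_nth 0 i).
have st : size s1 = size (take (size s1) t) by rewrite size_take i.
rewrite !zip_cat // !map_cat /= (measuring_linear mP) wedge_cons_lin //.
by rewrite size_map size_zip -st minnn -tn.
Qed.

Let F_lin t1 t2 a u v s : size s = n -> (size t1 + size t2).+1 = n ->
  F (t1 ++ (a *: u + v) :: t2) s = a *: F (t1 ++ u :: t2) s + F (t1 ++ v :: t2) s.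
Proof.
move=> sn E; rewrite /F.
have i : (size t1 < size s)%N by lia.
rewrite -(cat_take_drop (size t1) s) (drop_nth 0 i).
have st : size (take (size t1) s) = size t1 by rewrite size_take i.
rewrite !zip_cat // !map_cat /= linearP wedge_cons_lin //.
by rewrite size_map size_zip st minnn; lia.
Qed.

Let F_adj t1 t2 u w s : size s = n -> (size t1 + size t2).+2 = n ->
  F (t1 ++ u :: w :: t2) (adj (size t1) s) = - F (t1 ++ w :: u :: t2) s.
Proof.
move=> sn E; rewrite /F.
have i : (size t1 < size s)%N by lia.
have i' : ((size t1).+1 < size s)%N by lia.
rewrite -{2}(cat_take_drop (size t1) s) (drop_nth 0 i) (drop_nth 0 i') /adj.
have st : size (take (size t1) s) = size t1 by rewrite size_take i.
rewrite !zip_cat // !map_cat /= wedge_swap //.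
by rewrite size_map size_zip st minnn; lia.
Qed.

Let swF_adj t1 t2 u w x : (size t1 + size t2).+2 = n ->
  sweedlern n (F (t1 ++ u :: w :: t2)) x = - sweedlern n (F (t1 ++ w :: u :: t2)) x.
Proof.
move=> E; rewrite -(@sw_adj _ _ _ n (size t1)); [|lia|by apply: F_mlin; rewrite size_cat /=; lia].
have z0 : mlin n (fun _ : seq C => 0 : ext n g') by move=> *; rewrite scaler0 addr0.
have sz : sweedlern n (fun _ : seq C => 0 : ext n g') x = 0.
  have := @sw_comb _ _ _ n _ _ (-1) x z0 z0; rewrite [X in _ = X + _]scaleN1r addNr => H.
  rewrite -[RHS]H; by apply: sw_ext => *; rewrite scaler0 addr0.
rewrite (@sw_ext _ _ _ n _ (fun s => -1 *: F (t1 ++ [:: w, u & t2]) s + 0)).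
  by rewrite sw_comb ?sz ?addr0 ?scaleN1r //; apply: F_mlin; rewrite size_cat /=; lia.
by move=> s sn; rewrite F_adj // scaleN1r addr0.
Qed.

Let swF_alt t1 t2 t3 u x : (size t1 + size t2 + size t3).+2 = n ->
  sweedlern n (F (t1 ++ u :: t2 ++ u :: t3)) x = 0.
Proof.
elim/last_ind: t2 t3 => [|t2 w IH] t3 E.
  have : (size t1 + size t3).+2 = n by move: E => /=; lia.
  move=> /(@swF_adj t1 t3 u u x) /eqP /=.
  rewrite -addr_eq0 -mulr2n -scaler_nat scaler_eq0 (negbTE K2) /=.
  by move/eqP.
rewrite size_rcons in E.
rewrite cat_rcons -cat_cons catA swF_adj; last by rewrite size_cat /=; lia.
by rewrite -catA cat_cons IH ?oppr0 //= ; lia.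
Qed.

Lemma ce_measuringE (x : C) (t : n.-tuple g) :
  ce_measuring Psi x (wedge n t : ext n g) =
  sweedlern n (fun s : seq C => wedge n [seq Psi ya.1 ya.2 | ya <- zip s t]) x.
Proof.
rewrite /ce_measuring elift_wedge // => {}t.
  move=> i a u v; have kt := ltn_ord i.
  have E y : tval (upd t i y) = take i t ++ y :: drop i.+1 t.
    apply: (@eq_from_nth _ 0); first by rewrite size_cat /= size_take size_drop !size_tuple kt ?card_ord; lia.
    move=> k _; rewrite nth_upd nth_cat size_take size_tuple kt.
    case: ltngtP => [ki|ki|->]; last by rewrite subnn.
      by rewrite nth_take.
    rewrite -(subnSK ki) /= nth_drop; congr nth; lia.
  rewrite -[X in sweedlern n X x]/(F (tval _)) -[X in _ *: sweedlern n X x + _]/(F (tval _)).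
  rewrite -[X in _ = _ *: _ + sweedlern n X x]/(F (tval _)) !E.
  have sz : (size (take i t) + size (drop i.+1 t)).+1 = n.
    by rewrite size_take size_drop !size_tuple kt; lia.
  rewrite -sw_comb; try by apply: F_mlin; rewrite size_cat /= addnS sz.
  by apply: sw_ext => s sn; apply: F_lin.
move=> i j; wlog: i j / (i < j)%N.
  move=> W ij tij; case: (ltngtP i j) => H; [exact: (W i j)|apply: (W j i) => //|].
    by rewrite eq_sym.
  by move: ij; rewrite (val_inj H) eqxx.
move=> ij _; rewrite !(tnth_nth 0) => tij.
have jn := ltn_ord j.
have E : tval t = take i t ++ t`_i :: take (j - i.+1) (drop i.+1 t) ++ t`_i :: drop j.+1 t.
  rewrite -{1}(cat_take_drop i t) (drop_nth 0); last by rewrite size_tuple; lia.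
  congr (_ ++ _ :: _); rewrite -{1}(cat_take_drop (j - i.+1) (drop i.+1 t)) drop_drop.
  rewrite tij (subnK ij) -drop_nth // size_tuple; lia.
rewrite -[X in sweedlern n X x]/(F (tval t)) E; apply: swF_alt.
have -> : size (take i t) = i by rewrite size_takel // size_tuple; lia.
have -> : size (take (j - i.+1) (drop i.+1 t)) = (j - i.+1)%N by rewrite size_takel // size_drop size_tuple; lia.
by rewrite size_drop size_tuple; lia.
Qed.
End Meas.

(* Main.v *)
Require Import Defs.
From HB Require Import structures.
From mathcomp Require Import all_boot all_order all_algebra.
From mathcomp Require Import boolp classical_sets.
From mathcomp Require Import freeg zify.

Set Implicit Arguments.
Unset Strict Implicit.
Unset Printing Implicit Defensive.
Import GRing.Theory.
Local Open Scope ring_scope.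

(** The diagram already commutes on chains.  Write [M x] for the chain map
    attached to [x] and [ce_coprod] for the composite of the diagonal
    [CE(g) -> CE(g + g)] with the inverse of [CE(g) (x) CE(g) -> CE(g + g)].
    The heart of the matter is
      [ce_coprod (M x u) = sum (M x_(1) (x) M x_(2)) (ce_coprod u)],
    which is [ce_coprod_measuring].  An exterior algebra is generated from degree
    0 by the operators [a /\ -], so this follows by induction on the degree from
    two recursions:
      [M x (a /\ u) = sum (Psi x_(1) a) /\ (M x_(2) u)],
      [ce_coprod (a /\ u) = a . ce_coprod u],
    where [a . (u (x) v) = (a /\ u) (x) v + (-1)^p u (x) (a /\ v)] for [u] of
    degree [p].  The two sides then differ by the order of the tensor factors of
    the iterated coproduct of [x], and [C] is coassociative and cocommutative.

    The same induction gives all the chain-level facts needed to pass to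
    homology.  The differential is controlled by Cartan's formula
    [d (a /\ u) = L_a u - a /\ d u]: the Lie derivative [L_a] satisfies
    [L_a (b /\ u) = b /\ L_a u + [a, b] /\ u], whence [d d = 0] ([ce_bd_sq]) and
    the fact that the maps induced by Lie morphisms ([ext_map_bd]), the map
    [ext_sum] ([ext_sum_bd]) and [M x] ([ce_measuring_bd]) are chain maps.
    The operators [a . -] of the second recursion, extended to pairs [(a, b)],
    square to zero, so they define a map out of the exterior powers of [g + g];
    this map is the inverse of [ext_sum] ([ext_sumK], [ext_splitK]).

    Finally the coproduct in homology involves the inverse of the Kunneth map, so
    that map must be bijective.  Over a field the homology of a complex is a
    homotopy retract of it ([homotopyP]); tensoring two such retractions shows that
    Kunneth is injective ([kunneth_inj]) and surjective ([kunneth_surj]).  It is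
    moreover natural for chain maps ([kunneth_natural]), and the theorem follows by
    applying it to both sides of the diagram. *)

(** * Generalized inverses of linear maps *)

Section GeneralizedInverse.
Variables (K : fieldType) (V W : lmodType K) (f : {linear V -> W}).

(** A linear graph from [W] to [V] whose values at points of the image of [f] are
    preimages of these points.  Points outside the image are also allowed in the
    domain, so that a maximal such graph is total. *)
Definition partial_inverse (G : set (W * V)) :=
  [/\ forall a x y, G x -> G y -> G (a *: x + y),
      forall v, G (0, v) -> v = 0 &
      forall u v, G (f u, v) -> f v = f u].

(** A new point [w] is adjoined with a value [v] that is forced only when some
    translate of [w] by the domain of [G] meets the image of [f]; otherwise [0]
    will do. *)
Lemma partial_inverse_extend (G : set (W * V)) (w : W) : partial_inverse G -> G 0 ->
  (forall v, ~ G (w, v)) ->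
  exists2 H : set (W * V), partial_inverse H & (G `<` H)%classic.
Proof.
move=> [Glin Gfun Gf] G0 Gw.
have GZ a x : G x -> G (a *: x) by move=> Gx; rewrite -[_ *: _]addr0; apply: Glin.
suff [w1 [v1 [Gw1 H1]]] : exists w1 v1, (forall v, ~ G (w1, v)) /\
    forall a y u, G y -> f u = a *: w1 + y.1 -> f (a *: v1 + y.2) = f u.
  have a0 a y : G y -> a *: w1 + y.1 = 0 -> a = 0.
    move=> Gy /eqP e; apply/eqP/negP => /negP a0.
    case: (Gw1 (- a^-1 *: y.2)).
    have -> : w1 = - a^-1 *: y.1.
      move: e; rewrite addr_eq0 => /eqP e.
      by rewrite -[w1]scale1r -(mulVf a0) -scalerA e scalerN scaleNr.
    exact: (GZ _ _ Gy).
  exists [set z | exists a y, G y /\ z = (a *: w1 + y.1, a *: v1 + y.2)]%classic.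
    split=> [a _ _ [b [y [Gy ->]]] [c [z [Gz ->]]]|v [a [y [Gy [e1 ->]]]]|u v].
    - exists (a * b + c), (a *: y + z); split; first exact: Glin.
      congr pair; rewrite /= !scalerDr !scalerDl !scalerA addrACA //.
    - have := a0 a y Gy (esym e1) => az; move: e1; rewrite az !scale0r !add0r => e1.
      by apply: Gfun; rewrite e1 -surjective_pairing.
    - by move=> [a [y [Gy [e ->]]]]; apply: H1.
  split=> [y Gy|HG].
    by exists 0, y; rewrite !scale0r !add0r -surjective_pairing.
  by apply: (Gw1 v1); apply: HG; exists 1, 0; rewrite !scale1r !addr0.
(* If f u = w + y.1, then w is replaced by f u, whose value must be a preimage: take u. *)
have [[y [u [Gy e]]]|H] := pselect (exists y u, G y /\ f u = w + y.1).
  exists (f u), u; split=> [v Gv|a z u' Gz e'].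
    apply: (Gw (v - y.2)).
    have -> : (w, v - y.2) = (-1 : K) *: y + (f u, v).
      by rewrite e scaleN1r; congr pair => /=; rewrite addrC ?addrK.
    exact: Glin.
  have ez : z.1 = f (u' - a *: u) by rewrite linearB linearZ /= e' addrC addKr.
  have /Gf : G (f (u' - a *: u), z.2) by rewrite -ez -surjective_pairing.
  by rewrite linearP linearB linearZ /= => ->; rewrite addrC subrK.
exists w, 0; split=> // a y u Gy e.
have [az|az] := eqVneq a 0.
  move: e; rewrite az !scale0r !add0r => e.
  by apply: Gf; rewrite e -surjective_pairing.
case: H; exists (a^-1 *: y), (a^-1 *: u); split; first exact: GZ.
by rewrite linearZ /= e scalerDr scalerA mulVf // scale1r.
Qed.

(** Splits every short exact sequence below: it provides linear sections of
    surjections as well as partial inverses of differentials. *)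
Lemma lin_ginv : exists g : {linear W -> V}, forall v, f (g (f v)) = f v.
Proof.
have [|G [PG Gmax]] := @Zorn_bigcup _ partial_inverse.
  move=> F FP Ftot; split=> [a x y [A FA Ax] [B FB By]|v [A FA Av]|u v [A FA Av]].
  - have [AB|BA] := Ftot _ _ FA FB.
      by exists B => //; case: (FP _ FB) => l _ _; apply: l => //; apply: AB.
    by exists A => //; case: (FP _ FA) => l _ _; apply: l => //; apply: BA.
  - by case: (FP _ FA) => _ h _; apply: h.
  - by case: (FP _ FA) => _ _ h; apply: h.
case: (PG) => Glin Gfun Gf.
have G0 : G 0.
  have [[x Gx]|G0] := pselect (exists x, G x).
    by rewrite -(addNr x) -scaleN1r; apply: Glin.
  case: (Gmax [set 0]%classic).
    split=> [x Gx|H]; first by case: G0; exists x.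
    by case: G0; exists 0; apply: H.
  split=> [a x y -> ->|v [->]//|u v [-> ->]]; first by rewrite scaler0 addr0.
  by rewrite raddf0.
have Gtot w : exists v, G (w, v).
  apply/not_existsP => Gw; have [H PH GH] := partial_inverse_extend PG G0 Gw.
  exact: (Gmax H).
pose g w := projT1 (cid (Gtot w)).
have gP w : G (w, g w) by rewrite /g; case: cid.
have Guniq w v v' : G (w, v) -> G (w, v') -> v = v'.
  move=> G1 G2; apply/eqP; rewrite -subr_eq0; apply/eqP; apply: Gfun.
  have := Glin (-1) _ _ G2 G1.
  by rewrite scaleN1r; congr G; congr pair; rewrite /= addrC ?subrr.
have gl : linear g.
  by move=> a u v; apply: Guniq (gP _) _; exact: (Glin a _ _ (gP u) (gP v)).
pose M := GRing.isLinear.Build K W V *:%R g gl.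
pose gL : {linear W -> V} := HB.pack g M.
by exists gL => v; apply: Gf; exact: gP.
Qed.
End GeneralizedInverse.

(** * Linear maps out of tensor products and direct sums *)

(** The one-variable analogue of [bil], for maps without a bundled linear
    structure. *)
Definition lin (K : fieldType) (V W : lmodType K) (f : V -> W) :=
  forall a u v, f (a *: u + v) = a *: f u + f v.

Section Generators.
Variable K : fieldType.

Lemma linear_at0 (V W : lmodType K) (f : V -> W) : lin f -> f 0 = 0.
Proof.
by move=> lf; have := lf (-1) 0 0; rewrite scaler0 addr0 scaleN1r addNr.
Qed.

Lemma linear_atD (V W : lmodType K) (f : V -> W) u v :
  lin f -> f (u + v) = f u + f v.
Proof. by move=> lf; have := lf 1 u v; rewrite !scale1r. Qed.

Lemma linear_atZ (V W : lmodType K) (f : V -> W) a u :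
  lin f -> f (a *: u) = a *: f u.
Proof. by move=> lf; have := lf a u 0; rewrite (linear_at0 lf) !addr0. Qed.

Lemma linear_atB (V W : lmodType K) (f : V -> W) u v :
  lin f -> f (u - v) = f u - f v.
Proof. by move=> lf; rewrite (linear_atD _ _ lf) -scaleN1r (linear_atZ _ _ lf) scaleN1r. Qed.

Lemma linear_comp (U V W : lmodType K) (f : V -> W) (h : U -> V) :
  lin f -> lin h -> lin (fun u => f (h u)).
Proof. by move=> lf lh a u v; rewrite lh lf. Qed.

Lemma linear_comb (V W : lmodType K) (f h : V -> W) b :
  lin f -> lin h -> lin (fun v => b *: f v + h v).
Proof.
by move=> lf lh a u v; rewrite lf lh !scalerDr !scalerA [b * a]mulrC addrACA.
Qed.

Lemma linear_add (V W : lmodType K) (f h : V -> W) :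
  lin f -> lin h -> lin (fun v => f v + h v).
Proof. by move=> lf lh a u v; rewrite lf lh scalerDr addrACA. Qed.

Lemma linear_scale (V W : lmodType K) (f : V -> W) b :
  lin f -> lin (fun v => b *: f v).
Proof. by move=> lf a u v; rewrite lf scalerDr !scalerA mulrC. Qed.

Lemma linear_opp (V W : lmodType K) (f : V -> W) :
  lin f -> lin (fun v => - f v).
Proof. by move=> lf a u v; rewrite lf opprD scalerN. Qed.

Lemma linear_zero (V W : lmodType K) : lin (fun _ : V => 0 : W).
Proof. by move=> a u v; rewrite scaler0 addr0. Qed.

Lemma linear_id (V : lmodType K) : lin (fun v : V => v).
Proof. by []. Qed.

Lemma bil_linl (V W U : lmodType K) (f : V -> W -> U) w :
  bil f -> lin (fun v => f v w).
Proof. by move=> [H _] a u v; apply: H. Qed.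

Lemma bil_linr (V W U : lmodType K) (f : V -> W -> U) v : bil f -> lin (f v).
Proof. by move=> [_ H] a x y; apply: H. Qed.

Lemma bil0l (V W U : lmodType K) (f : V -> W -> U) w : bil f -> f 0 w = 0.
Proof. by move=> bf; apply: (linear_at0 (bil_linl w bf)). Qed.

Lemma bil0r (V W U : lmodType K) (f : V -> W -> U) v : bil f -> f v 0 = 0.
Proof. by move=> bf; apply: (linear_at0 (bil_linr v bf)). Qed.

Lemma bilBl (V W U : lmodType K) (f : V -> W -> U) u v w :
  bil f -> f (u - v) w = f u w - f v w.
Proof. by move=> [H _]; rewrite -scaleN1r addrC H scaleN1r addrC. Qed.

Lemma bilBr (V W U : lmodType K) (f : V -> W -> U) w u v :
  bil f -> f w (u - v) = f w u - f w v.
Proof. by move=> [_ H]; rewrite -scaleN1r addrC H scaleN1r addrC. Qed.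

(** Polarization: an alternating family of operators anticommutes. *)
Lemma bil_anticomm (V U U' U'' : lmodType K) (f : V -> U -> U') (h : V -> U' -> U'')
    x y w : bil f -> bil h -> (forall x w, h x (f x w) = 0) ->
  h x (f y w) = - h y (f x w).
Proof.
move=> bf bh sq; have := sq (x + y) w.
rewrite (linear_atD _ _ (bil_linl w bf)) (linear_atD _ _ (bil_linl _ bh)).
rewrite !(linear_atD _ _ (bil_linr _ bh)) !sq add0r addr0 => /eqP.
by rewrite addr_eq0 => /eqP.
Qed.

Lemma bil_lin (V W U U' : lmodType K) (F : U -> U') (f : V -> W -> U) :
  lin F -> bil f -> bil (fun v w => F (f v w)).
Proof.
by move=> lF [f1 f2]; split=> a x y z; [rewrite f1|rewrite f2]; rewrite lF.
Qed.

Lemma bil_comp (V W V' W' U : lmodType K) (h : V' -> V) (k : W' -> W)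
    (f : V -> W -> U) :
  lin h -> lin k -> bil f -> bil (fun v w => f (h v) (k w)).
Proof.
move=> lh lk [f1 f2].
by split=> a x y z; [rewrite lh f1|rewrite lk f2].
Qed.

Lemma bil_flip (V W U : lmodType K) (f : V -> W -> U) :
  bil f -> bil (fun w v => f v w).
Proof. by move=> [f1 f2]; split=> a x y z; [apply: f2|apply: f1]. Qed.

Lemma bil_add (V W U : lmodType K) (f h : V -> W -> U) :
  bil f -> bil h -> bil (fun v w => f v w + h v w).
Proof.
move=> [f1 f2] [h1 h2].
by split=> a x y z; [rewrite f1 h1|rewrite f2 h2]; rewrite scalerDr addrACA.
Qed.

Lemma bil_zero (V W U : lmodType K) : bil (fun (_ : V) (_ : W) => 0 : U).
Proof. by split=> *; rewrite scaler0 addr0. Qed.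

(** This and the lemmas on tensors and graded tensors derived from it replace
    induction on elements: an identity that is linear in its argument has to be
    checked on generators only. *)
Lemma pres_eq (X : choiceType) (S : set {freeg X / K}) (U : lmodType K)
    (f h : pres S -> U) : lin f -> lin h ->
  (forall x, f (gen S x) = h (gen S x)) -> f =1 h.
Proof.
move=> lf lh fh; apply: pres_ind => [a x w IH|]; first by rewrite lf lh fh IH.
by rewrite !linear_at0.
Qed.

Lemma tens_eq (V W U : lmodType K) (f h : tensor V W -> U) :
  lin f -> lin h -> (forall v w, f (tens v w) = h (tens v w)) -> f =1 h.
Proof. by move=> lf lh fh; apply: pres_eq => // -[v w]; apply: fh. Qed.

Lemma dinj_linear (I : choiceType) (V : I -> lmodType K) i :
  lin (@dinj K I V i).
Proof.
move=> a v w; apply/eqP; rewrite -subr_eq0 opprD addrA; apply/eqP.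
by rewrite /dinj /gen -linearZ -!raddfB; apply: lpi_rel; exists i, a, v, w.
Qed.

Lemma ginj_linear (V W : nat -> lmodType K) n p q (e : (p + q == n)%N) :
  lin (@ginj K V W n p q e).
Proof.
exact: (@dinj_linear _ (fun i : bidegree n => tensor (V (val i).1) (W (val i).2))
  (exist _ (p, q) e)).
Qed.

Lemma ginj_irr (V W : nat -> lmodType K) n p q (e e' : (p + q == n)%N) t :
  @ginj K V W n p q e t = ginj e' t.
Proof. by rewrite (bool_irrelevance e e'). Qed.

Lemma ginj_bil (V W : nat -> lmodType K) n p q (e : (p + q == n)%N) :
  bil (fun v w => @ginj K V W n p q e (tens v w)).
Proof. exact: bil_lin (ginj_linear e) (tens_bil (V p) (W q)). Qed.

Lemma gtensor_ind (V W : nat -> lmodType K) n (P : gtensor V W n -> Prop) :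
  P 0 -> (forall a t t', P t -> P t' -> P (a *: t + t')) ->
  (forall p q (e : (p + q == n)%N) v w, P (ginj e (tens v w))) -> forall t, P t.
Proof.
move=> P0 Pl Pg; apply: pres_ind => [a [[[p q] e] t] w Pw|//].
apply: (Pl a) => //; rewrite -[gen _ _]/(ginj e t).
elim/tens_ind: t => [b u v t Pt|]; last by rewrite (linear_at0 (ginj_linear e)).
by rewrite ginj_linear; apply: Pl.
Qed.

Lemma gtensor_eq (V W : nat -> lmodType K) n (U : lmodType K)
    (f h : gtensor V W n -> U) : lin f -> lin h ->
  (forall p q (e : (p + q == n)%N) v w,
     f (ginj e (tens v w)) = h (ginj e (tens v w))) -> f =1 h.
Proof.
move=> lf lh fh; apply: gtensor_ind => [|a t t' e e'|//].
  by rewrite !linear_at0.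
by rewrite lf lh e e'.
Qed.

Lemma glift_linear (V W : nat -> lmodType K) n (U : lmodType K)
    (f : forall p q, (p + q == n)%N -> V p -> W q -> U) : lin (glift f).
Proof. exact: linearP. Qed.

Lemma gliftE (V W : nat -> lmodType K) n (U : lmodType K)
    (f : forall p q, (p + q == n)%N -> V p -> W q -> U) :
  (forall p q e, bil (f p q e)) ->
  forall p q e v w, glift f (ginj e (tens v w)) = f p q e v w.
Proof. by move=> bf; apply: glift_inj => p q e; case: (bf p q e). Qed.

Section Gmap.
Variables (V V' W W' : nat -> lmodType K).
Variables (f : forall n, V n -> V' n) (g : forall n, W n -> W' n).
Hypotheses (lf : forall n, lin (f (n := n))) (lg : forall n, lin (g (n := n))).

Lemma gmap_linear n : lin (@gmap K _ _ _ _ f g n).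
Proof. exact: glift_linear. Qed.

Lemma gmapE n p q (e : (p + q == n)%N) v w :
  gmap f g (ginj e (tens v w)) = ginj e (tens (f v) (g w)).
Proof.
rewrite /gmap gliftE // => p1 q1 e1.
refine (bil_comp (lf (n := p1)) (lg (n := q1)) (ginj_bil V' W' e1)).
Qed.
End Gmap.

Section TensorBd.
Variables C D : chain_complex K.

Lemma tbdl_bil n p q (e : (p + q == n.+1)%N) : bil (@tbdl K C D n p q e).
Proof.
case: p e => [|p] e; first exact: bil_zero.
apply: (bil_comp _ _ (ginj_bil C D (e : (p + q == n)%N))) => //; exact: linearP.
Qed.

Lemma tbdr_bil n p q (e : (p + q == n.+1)%N) : bil (@tbdr K C D n p q e).
Proof.
case: q e => [|q] e; first exact: bil_zero.
apply: (bil_lin (F := fun t => (-1) ^+ p *: t)); first exact/linear_scale/linear_id.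
apply: (bil_comp _ _ (ginj_bil C D (bidegree_r e))) => //; exact: linearP.
Qed.

(** The differential of [tensor_complex C D], with the graded tensor product
    itself, rather than a component of that complex, as source and target. *)
Definition tbd n : gtensor C D n.+1 -> gtensor C D n :=
  glift (fun p q e v w => tbdl e v w + tbdr e v w).

Lemma tbd_linear n : lin (@tbd n).
Proof. exact: glift_linear. Qed.

Lemma tbdE n p q (e : (p + q == n.+1)%N) v w :
  tbd (ginj e (tens v w)) = tbdl e v w + tbdr e v w.
Proof.
rewrite /tbd gliftE // => {v w e} {}p {}q e.
exact: bil_add (tbdl_bil e) (tbdr_bil e).
Qed.

Lemma bd_tensorE n p q (e : (p + q == n.+1)%N) v w :
  bd (tensor_complex C D) n (ginj e (tens v w)) = tbdl e v w + tbdr e v w.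
Proof. exact: tbdE. Qed.
End TensorBd.
End Generators.

(** * Homology classes *)

Section Hclass.
Variables (K : fieldType) (C : chain_complex K) (n : nat).
Implicit Types (v z : C n) (h : homology C n).

Lemma hclassP h : is_cycle (hrep h) /\ hclass (hrep h) = h.
Proof.
have c : is_cycle (hrep h) := valP (repr (h : lquot (@boundary K C n))).
split=> //; rewrite /hclass /hrep.
have -> : insubd (0 : cycles C n) (\val (repr (h : lquot (@boundary K C n))))
  = repr (h : lquot (@boundary K C n)) by apply: val_inj; rewrite val_insubd valP.
exact: reprK.
Qed.

Lemma is_cycle_lin a u v : is_cycle u -> is_cycle v -> is_cycle (a *: u + v).
Proof. by case: (@is_cycle_closed K C n) => _ H cu cv; apply: H. Qed.

Lemma is_cycle0 : is_cycle (0 : C n).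
Proof. by case: (@is_cycle_closed K C n). Qed.

Lemma is_cycleB u v : is_cycle u -> is_cycle v -> is_cycle (u - v).
Proof. by move=> cu cv; rewrite -scaleN1r addrC; apply: is_cycle_lin. Qed.

Lemma hclass_lin a u v : is_cycle u -> is_cycle v ->
  hclass (a *: u + v) = a *: hclass u + hclass v.
Proof.
move=> cu cv; rewrite /hclass -linearP; congr lpi; apply: val_inj.
by rewrite linearP /= !val_insubd cu cv is_cycle_lin.
Qed.

Lemma hclass_eq0 z : is_cycle z -> hclass z = 0 <-> exists y, z = bd C n y.
Proof.
move=> cz; rewrite /hclass -(raddf0 (lpi (@boundary K C n))) lpiP subr0.
have vz : val (insubd (0 : cycles C n) z) = z by rewrite val_insubd cz.
split=> [/asboolP H|[y zy]]; last first.
  apply/asboolP => U _; apply; exists y; by rewrite vz.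
suff: `[< exists y, val (insubd (0 : cycles C n) z) = bd C n y >].
  by rewrite vz => /asboolP.
apply: (H (fun c => `[< exists y, val c = bd C n y >])) => [|s S]; last exact/asboolP.
split=> [|a u v /asboolP[y uy] /asboolP[y' vy']]; apply/asboolP.
  by exists 0; rewrite !raddf0.
by exists (a *: y + y'); rewrite !linearP /= uy vy'.
Qed.

Lemma eq_hclass u v : is_cycle u -> is_cycle v ->
  (exists y, u - v = bd C n y) -> hclass u = hclass v.
Proof.
move=> cu cv H.
have cuv := is_cycleB cu cv.
have /hclass_eq0 := H; move=> /(_ cuv) /eqP.
have -> : u - v = (-1) *: v + u by rewrite scaleN1r addrC.
by rewrite hclass_lin // scaleN1r addrC subr_eq0 => /eqP.
Qed.
Lemma hclass_inj u v : is_cycle u -> is_cycle v ->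
  hclass u = hclass v -> exists y, u - v = bd C n y.
Proof.
move=> cu cv uv; apply/hclass_eq0; first exact: is_cycleB.
by rewrite -scaleN1r addrC hclass_lin // uv scaleN1r addNr.
Qed.

End Hclass.

Lemma hmapE (K : fieldType) (C D : chain_complex K) (f : forall n, C n -> D n)
  (lf : forall n, lin (f n)) (cf : forall n u, bd D n (f _ u) = f _ (bd C n u)) n (z : C n) :
  is_cycle z -> is_cycle (f n z) /\ hmap f (hclass z) = hclass (f n z).
Proof.
have ccf v : is_cycle v -> is_cycle (f n v).
  case: n {z} v => // n v /eqP v0; apply/eqP.
  by rewrite [LHS]cf [bd C n v]v0 linear_at0.
move=> cz; split; first exact: ccf.
have [cr rE] := hclassP (hclass z).
apply: eq_hclass; [exact: ccf..|].
have cd : is_cycle (hrep (hclass z) - z) by apply: is_cycleB.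
have [|y yE] := (hclass_eq0 cd).1; last first.
  exists (f _ y); rewrite cf -yE -scaleN1r addrC -lf; congr f.
  by rewrite scaleN1r addrC.
have -> : hrep (hclass z) - z = (-1) *: z + hrep (hclass z) by rewrite scaleN1r addrC.
by rewrite hclass_lin // rE scaleN1r addNr.
Qed.

(** * The homology of a complex of vector spaces as a homotopy retract *)

Section Retract.
Variables (K : fieldType) (C : chain_complex K).
Hypothesis bd_cycle : forall n u, is_cycle (bd C n u).

Definition bd_ginv n : {linear C n -> C n.+1} := projT1 (cid (lin_ginv (bd C n))).

Lemma bd_ginvK n v : bd C n (bd_ginv n (bd C n v)) = bd C n v.
Proof. by rewrite /bd_ginv; case: cid. Qed.

Definition hsec n (h : homology C n) : C n :=
  val (projT1 (cid (lin_ginv (lpi (@boundary K C n)))) h).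

Lemma hsec_linear n : lin (@hsec n).
Proof. by move=> a u v; rewrite /hsec linearP. Qed.

Lemma hsecP n (h : homology C n) : is_cycle (hsec h) /\ hclass (hsec h) = h.
Proof.
rewrite /hsec; case: cid => f fE /=; split; first exact: valP.
rewrite /hclass.
have -> : insubd (0 : cycles C n) (val (f h)) = f h.
  by apply: val_inj; rewrite val_insubd valP.
by elim/lpiW: h => z; apply: fE.
Qed.

(** The projection onto the cycles along the image of [bd_ginv \o bd]. *)
Definition to_cycle n : C n -> C n :=
  match n with 0 => id | n'.+1 => fun v => v - bd_ginv n' (bd C n' v) end.

Lemma to_cycle_linear n : lin (@to_cycle n).
Proof.
case: n => [//|n] a u v /=.
by rewrite !linearP scalerBr scalerN addrACA.
Qed.

Lemma to_cycleP n v : is_cycle (@to_cycle n v).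
Proof. by case: n v => // n v; apply/eqP; rewrite /= linearB /= bd_ginvK subrr. Qed.

Lemma to_cycle_id n (z : C n) : is_cycle z -> to_cycle z = z.
Proof. by case: n z => //= n z /eqP z0; rewrite [bd C n z]z0 raddf0 subr0. Qed.

Definition hproj n (v : C n) : homology C n := hclass (to_cycle v).

Lemma hproj_linear n : lin (@hproj n).
Proof. by move=> a u v; rewrite /hproj to_cycle_linear hclass_lin //; apply: to_cycleP. Qed.

Lemma hproj_cycle n (z : C n) : is_cycle z -> hproj z = hclass z.
Proof. by move=> /to_cycle_id cz; rewrite /hproj cz. Qed.

Lemma hproj_bd n u : hproj (bd C n u) = 0.
Proof.
by rewrite hproj_cycle //; apply/hclass_eq0 => //; exists u.
Qed.

Lemma hproj_sec n (h : homology C n) : hproj (hsec h) = h.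
Proof. by have [c e] := hsecP h; rewrite hproj_cycle. Qed.

(** With [s] for this map, the argument of [bd_ginv] is a cycle of class zero, hence
    a boundary, and [d (s v)] is equal to it. *)
Definition homotopy n (v : C n) : C n.+1 := bd_ginv n (to_cycle v - hsec (hproj v)).

Lemma homotopy_linear n : lin (@homotopy n).
Proof.
move=> a u v; rewrite /homotopy to_cycle_linear hproj_linear hsec_linear.
by rewrite opprD addrACA -scalerBr linearP.
Qed.

Definition homotopy_bd n : C n -> C n :=
  match n with 0 => fun=> 0 | n'.+1 => fun v => homotopy (bd C n' v) end.

Lemma homotopyP n (v : C n) : v - hsec (hproj v) = bd C n (homotopy v) + homotopy_bd v.
Proof.
have -> : bd C n (homotopy v) = to_cycle v - hsec (hproj v).
  have [cs hs] := hsecP (hproj v).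
  have cv := to_cycleP v; have cd := is_cycleB cv cs.
  have [|y yE] := (hclass_eq0 cd).1; last by rewrite /homotopy yE bd_ginvK.
  by rewrite -scaleN1r addrC hclass_lin // hs scaleN1r addNr.
rewrite addrAC; congr (_ - _).
case: n v => [|n] v /=; first by rewrite addr0.
by rewrite /homotopy hproj_bd (linear_at0 (@hsec_linear n)) subr0 to_cycle_id // subrK.
Qed.
End Retract.

(** * The Kunneth map *)

Section Kunneth.
Variables (K : fieldType) (C D : chain_complex K).
Local Notation T := (tensor_complex C D).

Lemma tensor_cycle n p q (e : (p + q == n)%N) (u : C p) (v : D q) :
  is_cycle u -> is_cycle v -> is_cycle (ginj e (tens u v) : T n).
Proof.
case: n e => // n e cu cv; apply/eqP; rewrite bd_tensorE.
have -> : tbdl e u v = 0.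
  case: p e u cu => //= p e u /eqP u0; rewrite [bd C p u]u0.
  exact: bil0l _ (ginj_bil C D (e : (p + q == n)%N)).
rewrite add0r.
case: q e v cv => //= q e v /eqP v0; rewrite [bd D q v]v0.
by rewrite (bil0r _ (ginj_bil C D (bidegree_r e))) scaler0.
Qed.

(** An instance of [is_cycle_lin] in which the linear combination is formed in the
    graded tensor product. *)
Lemma tensor_cycle_lin n a (u v : gtensor C D n) :
  is_cycle (u : T n) -> is_cycle (v : T n) -> is_cycle (a *: u + v : T n).
Proof.
move=> cu cv.
have H : is_cycle (a *: (u : T n) + v) by apply: is_cycle_lin.
by suff <- : a *: (u : T n) + v = a *: u + v by [].
Qed.

Lemma gmap_sec_cycle n w : is_cycle (gmap (@hsec K C) (@hsec K D) w : T n).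
Proof.
elim/gtensor_ind: w => [|a t t' ct ct'|p q e u v].
- rewrite (linear_at0 (@gmap_linear _ _ _ _ _ _ _ n)); exact: is_cycle0.
- have H := @gmap_linear _ _ _ _ _ (@hsec K C) (@hsec K D) n a t t'.
  by rewrite H; refine (tensor_cycle_lin a ct ct').
rewrite gmapE; try exact: hsec_linear.
by apply: tensor_cycle; [case: (hsecP u)|case: (hsecP v)].
Qed.

Lemma tensor_hclass_lin n a (u v : gtensor C D n) :
  is_cycle (u : T n) -> is_cycle (v : T n) ->
  hclass (a *: u + v : T n) = a *: hclass (u : T n) + hclass (v : T n).
Proof.
move=> cu cv.
have H := hclass_lin a cu cv.
by rewrite -[X in hclass X]/(a *: (u : T n) + v).
Qed.

Lemma tensor_eq_hclass n (u v : gtensor C D n) : is_cycle (u : T n) ->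
  is_cycle (v : T n) -> (exists y, u - v = bd T n y) ->
  hclass (u : T n) = hclass (v : T n).
Proof. by move=> cu cv [y yE]; apply: eq_hclass => //; exists y; rewrite -yE. Qed.

(** If [u - u' = d y] then [(u - u') (x) v = d (y (x) v)], because [d v = 0]. *)
Lemma hclass_tensl n p q (e : (p + q == n)%N) u u' v :
  is_cycle u -> is_cycle u' -> is_cycle v -> hclass u = hclass u' ->
  hclass (ginj e (tens u v) : T n) = hclass (ginj e (tens u' v) : T n).
Proof.
move=> cu cu' cv /(hclass_inj cu cu') [y yE].
apply: tensor_eq_hclass; try exact: tensor_cycle.
exists (ginj (e : (p.+1 + q == n.+1)%N) (tens y v)).
transitivity (ginj e (tens (u - u') v)); first by rewrite (bilBl _ _ _ (ginj_bil C D e)).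
rewrite yE bd_tensorE /=.
have -> : tbdr (e : (p.+1 + q == n.+1)%N) y v = 0; last by rewrite addr0.
case: q e v cv => // q e v /eqP v0 /=; rewrite [bd D q v]v0.
by rewrite (bil0r _ (ginj_bil C D (bidegree_r (n := n) (p := p.+1) e))) scaler0.
Qed.

Lemma hclass_tensr n p q (e : (p + q == n)%N) u v v' :
  is_cycle u -> is_cycle v -> is_cycle v' -> hclass v = hclass v' ->
  hclass (ginj e (tens u v) : T n) = hclass (ginj e (tens u v') : T n).
Proof.
move=> cu cv cv' /(hclass_inj cv cv') [y yE].
apply: tensor_eq_hclass; try exact: tensor_cycle.
have e' : (p + q.+1 == n.+1)%N by rewrite addnS.
exists ((-1) ^+ p *: ginj e' (tens u y)).
transitivity (ginj e (tens u (v - v'))); first by rewrite (bilBr _ _ _ (ginj_bil C D e)).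
rewrite yE linearZ bd_tensorE /=.
have -> : tbdl e' u y = 0.
  case: p e u cu e' => // p e u /eqP u0 e' /=; rewrite [bd C p u]u0.
  exact: bil0l (ginj_bil C D (e' : (p + q.+1 == n)%N)).
by rewrite add0r scalerA -expr2 sqrr_sign scale1r (bool_irrelevance (bidegree_r e') e).
Qed.

Lemma hclass_sec_linear n : lin (fun w : gtensor (homology C) (homology D) n =>
  hclass (gmap (@hsec K C) (@hsec K D) w : T n)).
Proof.
move=> a t t'; have H := @gmap_linear _ _ _ _ _ (@hsec K C) (@hsec K D) n a t t'.
have H' := tensor_hclass_lin a (gmap_sec_cycle t) (gmap_sec_cycle t').
by rewrite -H'; congr (hclass (_ : T n)).
Qed.

(** Changing representatives does not change the class, so the arbitrary ones in
    the definition of [kunneth] can be replaced by the linear choice [hsec]. *)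
Lemma kunnethE n w : kunneth (n := n) w = hclass (gmap (@hsec K C) (@hsec K D) w : T n).
Proof.
pose F p q (e : (p + q == n)%N) h k : homology T n :=
  hclass (ginj e (tens (hrep h) (hrep k)) : T n).
have FE p q (e : (p + q == n)%N) h k :
    F p q e h k = hclass (gmap (@hsec K C) (@hsec K D) (ginj e (tens h k)) : T n).
  have [ch hE] := hclassP h; have [ck kE] := hclassP k.
  have [csh shE] := hsecP h; have [csk skE] := hsecP k.
  rewrite gmapE; try exact: hsec_linear.
  rewrite -(hclass_tensl e ch csh csk) ?hE ?shE //.
  by rewrite -(hclass_tensr e ch ck csk) ?kE ?skE.
have bF p q (e : (p + q == n)%N) : bil (F p q e).
  have b := ginj_bil (homology C) (homology D) e.
  have := bil_lin (@hclass_sec_linear n) b.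
  by move=> [b1 b2]; split=> *; rewrite !FE; [exact: b1|exact: b2].
move: w; apply: gtensor_eq => [||p q e h k].
- exact: glift_linear.
- exact: hclass_sec_linear.
by rewrite -FE -(gliftE bF).
Qed.
End Kunneth.

Lemma hmap_linear (K : fieldType) (C D : chain_complex K) (f : forall n, C n -> D n)
  (lf : forall n, lin (f n)) (cf : forall n u, bd D n (f _ u) = f _ (bd C n u)) n :
  lin (hmap f (n := n)).
Proof.
move=> a h h'; have [c e] := hclassP h; have [c' e'] := hclassP h'.
rewrite -{1}e -{1}e' -hclass_lin // (hmapE lf cf (is_cycle_lin a c c')).2.
by rewrite lf hclass_lin ?(hmapE lf cf c).1 ?(hmapE lf cf c').1.
Qed.

Lemma kunneth_linear (K : fieldType) (C D : chain_complex K) n :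
  lin (@kunneth K C D n).
Proof. exact: glift_linear. Qed.

Lemma kunneth_hclass (K : fieldType) (C D : chain_complex K) n p q
    (e : (p + q == n)%N) (u : C p) (v : D q) : is_cycle u -> is_cycle v ->
  kunneth (ginj e (tens (hclass u) (hclass v))) =
  hclass (ginj e (tens u v) : tensor_complex C D n).
Proof.
move=> cu cv; rewrite kunnethE gmapE; try exact: hsec_linear.
have [csu suE] := hsecP (hclass u); have [csv svE] := hsecP (hclass v).
by rewrite (hclass_tensl e csu cu csv) // (hclass_tensr e cu csv cv).
Qed.

Section GmapChain.
Variables (K : fieldType) (C D C' D' : chain_complex K).
Variables (f : forall n, C n -> C' n) (g : forall n, D n -> D' n).
Hypotheses (lf : forall n, lin (f (n := n))) (lg : forall n, lin (g (n := n))).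
Hypotheses (cf : forall n u, bd C' n (f u) = f (bd C n u))
           (cg : forall n u, bd D' n (g u) = g (bd D n u)).
Local Notation T := (tensor_complex C D).
Local Notation T' := (tensor_complex C' D').

Lemma gmap_bd n (w : gtensor C D n.+1) : tbd (gmap f g w) = gmap f g (tbd w).
Proof.
have gl m := @gmap_linear _ _ _ _ _ f g m.
move: w; apply: gtensor_eq => [||p q e u v].
- exact: linear_comp (@tbd_linear _ _ _ n) (gl _).
- exact: linear_comp (gl _) (@tbd_linear _ _ _ n).
rewrite (gmapE lf lg) !tbdE (linear_atD _ _ (gl n)); congr (_ + _).
  case: p e u => [|p] e u /=; first by rewrite (linear_at0 (gl n)).
  by rewrite (gmapE lf lg) cf.
case: q e v => [|q] e v /=; first by rewrite (linear_at0 (gl n)).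
by rewrite (linear_atZ _ _ (gl n)) (gmapE lf lg) cg.
Qed.

Lemma kunneth_natural n (w : gtensor (homology C) (homology D) n) :
  kunneth (gmap (fun n => @hmap K C C' f n) (fun n => @hmap K D D' g n) w) =
  hmap (C := T) (D := T') (fun n => @gmap K _ _ _ _ f g n) (kunneth w).
Proof.
have gl m := @gmap_linear _ _ _ _ _ f g m.
have hl := hmap_linear (C := T) (D := T') gl gmap_bd (n := n).
have hlf m := hmap_linear lf cf (n := m).
have hlg m := hmap_linear lg cg (n := m).
move: w; apply: gtensor_eq => [||p q e h k].
- exact: linear_comp (kunneth_linear (n := n)) (gmap_linear _ _ (n := n)).
- exact: linear_comp hl (kunneth_linear (n := n)).
have [ch hE] := hclassP h; have [ck kE] := hclassP k.
have [cfh fhE] := hmapE lf cf ch; have [cgk gkE] := hmapE lg cg ck.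
have := kunneth_hclass e ch ck; rewrite hE kE => ->.
rewrite gmapE // -{1}hE -{1}kE fhE gkE kunneth_hclass //.
by rewrite (hmapE (C := T) (D := T') gl gmap_bd (tensor_cycle e ch ck)).2 gmapE.
Qed.
End GmapChain.

(** * Bijectivity of the Kunneth map over a field *)

Lemma bidegreeS n p q : (p + q == n)%N -> (p + q.+1 == n.+1)%N.
Proof. by rewrite addnS. Qed.

Section KunnethBijective.
Variables (K : fieldType) (C D : chain_complex K).
Hypotheses (cC : forall n u, is_cycle (bd C n u)) (cD : forall n u, is_cycle (bd D n u)).
Local Notation T := (tensor_complex C D).
Let pl m := @hproj_linear K C m.
Let pr m := @hproj_linear K D m.
Let sl m := @hsec_linear K C m.
Let sr m := @hsec_linear K D m.

Lemma gmap_proj_bd n w : gmap (@hproj K C) (@hproj K D) (tbd (n := n) w) = 0.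
Proof.
have gl := @gmap_linear _ _ _ _ _ (@hproj K C) (@hproj K D) n.
move: w; apply: (gtensor_eq (h := fun=> 0)) => [||p q e u v].
- exact: linear_comp gl (@tbd_linear _ _ _ n).
- exact: linear_zero.
rewrite tbdE (linear_atD _ _ gl).
have -> : gmap (@hproj K C) (@hproj K D) (tbdl e u v) = 0.
  case: p e u => [|p] e u /=; first by rewrite (linear_at0 gl).
  by rewrite (gmapE pl pr) hproj_bd // (bil0l _ (ginj_bil _ _ _)).
rewrite add0r.
case: q e v => [|q] e v /=; first by rewrite (linear_at0 gl).
by rewrite (linear_atZ _ _ gl) (gmapE pl pr) hproj_bd // (bil0r _ (ginj_bil _ _ _)) scaler0.
Qed.

Lemma gmap_proj_sec n (w : gtensor (homology C) (homology D) n) :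
  gmap (@hproj K C) (@hproj K D) (gmap (@hsec K C) (@hsec K D) w) = w.
Proof.
move: w; apply: gtensor_eq => [||p q e u v].
- exact: linear_comp (gmap_linear _ _ (n := n)) (gmap_linear _ _ (n := n)).
- exact: linear_id.
by rewrite !gmapE // !hproj_sec.
Qed.

(** The projections [hproj (x) hproj] kill boundaries and are inverse to
    [hsec (x) hsec], so no nonzero [w] has [(hsec (x) hsec) w] a boundary. *)
Lemma kunneth_inj n : injective (@kunneth K C D n).
Proof.
move=> w w' E; apply/eqP; rewrite -subr_eq0; apply/eqP.
have : kunneth (w - w') = 0.
  by rewrite -scaleN1r addrC kunneth_linear E scaleN1r addNr.
rewrite kunnethE => /(hclass_eq0 (gmap_sec_cycle _)) [y yE].
rewrite -[LHS]gmap_proj_sec.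
by rewrite -[RHS](gmap_proj_bd y); congr gmap.
Qed.
(** With [s] the homotopy of each factor and [e = hsec hproj], this is
    [s (x) 1 + e (x) s], the standard homotopy from [1 (x) 1] to [e (x) e]. *)
Definition tensor_homotopy n : gtensor C D n -> gtensor C D n.+1 :=
  glift (fun p q e u v =>
    ginj (e : (p.+1 + q == n.+1)%N) (tens (homotopy u) v) +
    (-1) ^+ p *: ginj (bidegreeS e) (tens (hsec (hproj u)) (homotopy v))).

Let homotopyC m := @homotopy_linear K C m.
Let homotopyD m := @homotopy_linear K D m.

Lemma tensor_homotopy_linear n : lin (@tensor_homotopy n).
Proof. exact: glift_linear. Qed.

Lemma tensor_homotopyE n p q (e : (p + q == n)%N) u v :
  tensor_homotopy (ginj e (tens u v)) =
  ginj (e : (p.+1 + q == n.+1)%N) (tens (homotopy u) v) +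
  (-1) ^+ p *: ginj (bidegreeS e) (tens (hsec (hproj u)) (homotopy v)).
Proof.
rewrite /tensor_homotopy gliftE // => {u v e} {}p {}q e; apply: bil_add.
  refine (bil_comp (@homotopyC p) (@linear_id K (D q)) (ginj_bil C D (e : (p.+1 + q == n.+1)%N))).
apply: (bil_lin (F := fun t => (-1) ^+ p *: t)); first exact/linear_scale/linear_id.
refine (bil_comp (linear_comp (@sl p) (@pl p)) (@homotopyD q) (ginj_bil C D (bidegreeS e))).
Qed.

Definition tensor_homotopy_bd n : gtensor C D n -> gtensor C D n :=
  match n with 0 => fun=> 0 | n'.+1 => fun t => tensor_homotopy (tbd t) end.

(** Of the four terms of this composite, [e (d u) (x) s v] vanishes, and
    the remaining mixed one, [s u (x) d v], is minus the right half of the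
    differential of [s u (x) v]. *)
Lemma tensor_homotopy_bdE n p q (e : (p + q == n)%N) u v :
  tensor_homotopy_bd (ginj e (tens u v)) =
  ginj e (tens (homotopy_bd u) v) - tbdr (e : (p.+1 + q == n.+1)%N) (homotopy u) v +
  ginj e (tens (hsec (hproj u)) (homotopy_bd v)).
Proof.
have hs0 m : hsec (0 : homology C m) = 0 := linear_at0 (@sl m).
case: n e => [|n] e.
  case: p u e => [|//] u; case: q v => [|//] v e /=.
  by rewrite (bil0l _ (ginj_bil C D e)) (bil0r _ (ginj_bil C D e)) subr0 addr0.
rewrite [LHS]/= tbdE (linear_atD _ _ (@tensor_homotopy_linear n)).
case: p u e => [|p] u e.
  case: q v e => [//|q] v e /=.
  rewrite (linear_at0 (@tensor_homotopy_linear n)) add0r (bil0l _ (ginj_bil C D e)).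
  rewrite scale1r tensor_homotopyE expr0 expr1 !scale1r scaleN1r opprK add0r.
  by congr (_ + _); apply: ginj_irr.
rewrite [tbdl _ _ _]/= tensor_homotopyE hproj_bd // hs0.
rewrite (bil0l _ (ginj_bil C D _)) scaler0 addr0 -addrA; congr (_ + _).
case: q v e => [|q] v e /=.
  by rewrite (linear_at0 (@tensor_homotopy_linear n)) oppr0 add0r (bil0r _ (ginj_bil C D e)).
rewrite (linear_atZ _ _ (@tensor_homotopy_linear n)) tensor_homotopyE.
rewrite scalerDr scalerA -expr2 sqrr_sign scale1r.
rewrite [in RHS]exprS mulN1r scaleNr opprK.
by congr (_ *: _ + _); apply: ginj_irr.
Qed.

Lemma tensor_homotopyP n w :
  w - gmap (@hsec K C) (@hsec K D) (gmap (@hproj K C) (@hproj K D) w) =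
  tbd (n := n) (tensor_homotopy w) + tensor_homotopy_bd w.
Proof.
have Sl m : lin (@tensor_homotopy_bd m).
  case: m => [|m]; first exact: linear_zero.
  exact: linear_comp (@tensor_homotopy_linear m) (@tbd_linear _ _ _ m).
move: w; apply: gtensor_eq => [||p q e u v].
- apply: linear_add; first exact: linear_id.
  apply: linear_opp.
  exact: linear_comp (gmap_linear _ _ (n := n)) (gmap_linear _ _ (n := n)).
- apply: linear_add; last exact: Sl.
  exact: linear_comp (@tbd_linear _ _ _ n) (@tensor_homotopy_linear n).
rewrite (gmapE pl pr) (gmapE sl sr) tensor_homotopyE tensor_homotopy_bdE.
rewrite (linear_atD _ _ (@tbd_linear _ _ _ n)) (linear_atZ _ _ (@tbd_linear _ _ _ n)) !tbdE.
have -> : tbdl (bidegreeS e) (hsec (hproj u)) (homotopy v) = 0.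
  case: p u e => //= p u e; have [cs _] := hsecP (hproj u).
  by rewrite (eqP cs) (bil0l _ (ginj_bil C D _)).
rewrite add0r /= scalerA -expr2 sqrr_sign scale1r.
rewrite (ginj_irr (bidegree_r (bidegreeS e)) e).
have b := ginj_bil C D e.
transitivity (ginj e (tens (u - hsec (hproj u)) v) +
              ginj e (tens (hsec (hproj u)) (v - hsec (hproj v)))).
  by rewrite (bilBl _ _ _ b) (bilBr _ _ _ b) addrA subrK.
rewrite !homotopyP //.
rewrite (linear_atD _ _ (bil_linl v b)) (linear_atD _ _ (bil_linr (hsec (hproj u)) b)).
set a := ginj _ _; set b' := ginj _ _; set x := ginj _ _; set y := ginj _ _.
set t := tbdr _ _ _.
by rewrite [RHS]addrACA [X in _ = X + _]addrACA subrr addr0.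
Qed.

(** A cycle [z] differs from [(hsec (x) hsec) ((hproj (x) hproj) z)] by the boundary
    of [tensor_homotopy z]. *)
Lemma kunneth_surj n (z : gtensor C D n) : is_cycle (z : tensor_complex C D n) ->
  kunneth (gmap (@hproj K C) (@hproj K D) z) = hclass (z : tensor_complex C D n).
Proof.
move=> cz; rewrite kunnethE; apply: tensor_eq_hclass => //; first exact: gmap_sec_cycle.
exists (- tensor_homotopy z).
have S0 : tensor_homotopy_bd z = 0.
  case: n z cz => // n z cz; rewrite /= -[tbd z]/(bd (tensor_complex C D) n z) (eqP cz).
  exact: linear_at0 (@tensor_homotopy_linear n).
have := tensor_homotopyP z; rewrite S0 addr0 => H.
rewrite -opprB H; symmetry.
by have := linear_atZ (-1) (tensor_homotopy z) (@tbd_linear _ C D n); rewrite !scaleN1r.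
Qed.

End KunnethBijective.

(** * Exterior powers, generated by left multiplications *)

Section Exterior.
Variables (K : fieldType) (V : lmodType K).

Lemma upd_cat n (t : n.-tuple V) (i : 'I_n) v :
  upd t i v = take i t ++ v :: drop i.+1 t :> seq V.
Proof.
have kt := ltn_ord i; apply: (@eq_from_nth _ 0).
  by rewrite size_tuple size_cat /= size_take size_drop !size_tuple kt; lia.
move=> k _; rewrite nth_upd nth_cat size_take size_tuple kt.
case: ltngtP => [ki|ki|->]; last by rewrite subnn.
  by rewrite nth_take.
by rewrite -(subnSK ki) /= nth_drop; congr nth; lia.
Qed.

Lemma tuple_dup n (t : n.-tuple V) (i j : 'I_n) : i != j -> tnth t i = tnth t j ->
  exists s1 s2 s3 a, tval t = s1 ++ a :: s2 ++ a :: s3.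
Proof.
wlog: i j / (i < j)%N.
  move=> W ij tij; case: (ltngtP i j) => H; [exact: (W i j)|apply: (W j i) => //|].
    by rewrite eq_sym.
  by move: ij; rewrite (val_inj H) eqxx.
move=> ij _; rewrite !(tnth_nth 0) => tij.
have jn := ltn_ord j.
exists (take i t), (take (j - i.+1) (drop i.+1 t)), (drop j.+1 t), t`_i.
rewrite -{1}(cat_take_drop i t) (drop_nth 0); last by rewrite size_tuple; lia.
congr (_ ++ _ :: _); rewrite -{1}(cat_take_drop (j - i.+1) (drop i.+1 t)) drop_drop.
by rewrite tij (subnK ij) -drop_nth // size_tuple; lia.
Qed.

Lemma ext_eq n (U : lmodType K) (f h : ext n V -> U) : lin f -> lin h ->
  (forall s, size s = n -> f (wedge n s) = h (wedge n s)) -> f =1 h.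
Proof.
move=> lf lh fh; apply: pres_eq => // t.
by rewrite -wedge_tuple; apply: fh; rewrite size_tuple.
Qed.

Lemma elift_linear n (U : lmodType K) (f : n.-tuple V -> U) : lin (elift f).
Proof. exact: linearP. Qed.

Definition ext_cons n (a : V) : ext n V -> ext n.+1 V :=
  elift (fun t : n.-tuple V => wedge n.+1 (a :: t)).

HB.instance Definition _ n a := GRing.Linear.on (@ext_cons n a).

Lemma ext_cons_linear n a : lin (@ext_cons n a).
Proof. exact: elift_linear. Qed.

Lemma ext_consE n a s : size s = n -> ext_cons a (wedge n s) = wedge n.+1 (a :: s).
Proof.
move=> /eqP sn; rewrite -[s]/(tval (Tuple sn)) /ext_cons elift_wedge //.
  move=> t i b u v; rewrite !upd_cat -!cat_cons wedge_cons_lin //=.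
  by rewrite size_take size_tuple ltn_ord ltnS ltn_ord.
move=> t i j ij tij; have [s1 [s2 [s3 [b E]]]] := tuple_dup ij tij.
rewrite E -cat_cons wedge_dup //=.
have := congr1 size E; rewrite size_tuple !size_cat /= size_cat /=; lia.
Qed.

Lemma ext_cons_bil n : bil (@ext_cons n).
Proof.
split=> [a x y u|a x u v]; last exact: ext_cons_linear.
move: u; apply: ext_eq => [||s sn]; first exact: ext_cons_linear.
  by apply: linear_comb; apply: ext_cons_linear.
by rewrite !ext_consE //; apply: (@wedge_cons_lin _ _ _ [::]).
Qed.

Lemma ext_cons_sq n a (u : ext n V) : ext_cons a (ext_cons a u) = 0.
Proof.
move: u; apply: ext_eq => [||s sn].
- by apply: linear_comp; apply: ext_cons_linear.
- exact: linear_zero.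
rewrite !ext_consE //=; last by rewrite sn.
exact: (@wedge_dup _ _ n.+2 [::] [::]).
Qed.

Lemma ext0_eq (U : lmodType K) (f h : ext 0 V -> U) : lin f -> lin h ->
  f (wedge 0 [::]) = h (wedge 0 [::]) -> f =1 h.
Proof. by move=> lf lh e; apply: ext_eq => // s /size0nil ->. Qed.

Lemma extS_eq n (U : lmodType K) (f h : ext n.+1 V -> U) : lin f -> lin h ->
  (forall a u, f (ext_cons a u) = h (ext_cons a u)) -> f =1 h.
Proof.
move=> lf lh fh; apply: ext_eq => // -[//|a s] [sn].
by rewrite -ext_consE.
Qed.

Definition skip1 k (s : seq V) : seq V :=
  [seq s`_j | j <- iota 0 (size s) & j != k].

Lemma skip_shift (a : V) (s : seq V) (P : pred nat) :
  [seq (a :: s)`_j | j <- iota 1 (size s) & P j] =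
  [seq s`_j | j <- iota 0 (size s) & P j.+1].
Proof. by rewrite -[1%N]/(1 + 0)%N iotaDl filter_map -map_comp. Qed.

Lemma skip1_0 (a : V) (s : seq V) : skip1 0 (a :: s) = s.
Proof.
rewrite /skip1 /= skip_shift (@eq_filter _ _ predT) // filter_predT.
exact: mkseq_nth.
Qed.

Lemma skip1_S (a : V) (s : seq V) k : skip1 k.+1 (a :: s) = a :: skip1 k s.
Proof. by rewrite /skip1 /= skip_shift. Qed.

Lemma skip2_0 (a : V) (s : seq V) k : skip2 0 k.+1 (a :: s) = skip1 k s.
Proof. by rewrite /skip2 /= skip_shift. Qed.

Lemma skip2_S (a : V) (s : seq V) i j : skip2 i.+1 j.+1 (a :: s) = a :: skip2 i j s.
Proof. by rewrite /skip2 /= skip_shift. Qed.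

Lemma size_skip1 k s : (k < size s)%N -> size (skip1 k s) = (size s).-1.
Proof.
elim: s k => // a s IH [|k] ks; first by rewrite skip1_0.
rewrite skip1_S /= IH //; move: ks => /=; lia.
Qed.

Lemma size_skip2 i j (s : seq V) : (i < j)%N -> (j < size s)%N ->
  size (skip2 i j s) = (size s).-2.
Proof.
elim: s i j => // a s IH [|i] [|j] // ij js.
  by rewrite skip2_0 size_skip1.
rewrite skip2_S /= IH //; move: js => /=; lia.
Qed.
End Exterior.

(** * The Lie derivative and Cartan's formula *)

Lemma addr_cross (M : zmodType) (x p q r y s : M) :
  x + p + (q + r) - (y + q + (p + s)) = x - y + (r - s).
Proof.
rewrite [q + r]addrC addrACA [p + s]addrC [y + q + _]addrACA [q + p]addrC.
by rewrite opprD [LHS]addrACA subrr addr0 opprD [LHS]addrACA.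
Qed.

Lemma addr_cancel_cross (M : zmodType) (x y z w : M) :
  x - y + (z - x - w) = z - (y + w).
Proof. by rewrite addrACA [x + _]addrC subrK opprD. Qed.

Section LieDerivative.
Variables (K : fieldType) (g : lieAlgType K).

Lemma ce_bd_linear n : lin (@ce_bd K g n).
Proof. exact: linearP. Qed.

(** Defined by Cartan's formula, hence linear at once; that it is the derivation
    extending [lie a -] is [lie_deriv_wedge]. *)
Definition lie_deriv n (a : g) : ext n g -> ext n g :=
  match n with
  | 0 => fun=> 0
  | n'.+1 => fun u => ce_bd (ext_cons a u) + ext_cons a (ce_bd u)
  end.

Arguments lie_deriv : simpl never.

Lemma lie_deriv_linear n a : lin (@lie_deriv n a).
Proof.
case: n => [|n]; first exact: linear_zero.
by apply: linear_add; apply: linear_comp; first [exact: ce_bd_linear|exact: ext_cons_linear].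
Qed.

(** In [d (a /\ s)] the pairs that involve [a] give the right-hand side, and those
    that do not cancel against [a /\ d s]. *)
Lemma lie_deriv_wedge n a s : size s = n -> lie_deriv a (wedge n s) =
  \sum_(k < n) (-1) ^+ k *: wedge n (lie a s`_k :: skip1 k s).
Proof.
case: n => [|n] sn; rewrite /lie_deriv; first by rewrite big_ord0.
have sn1 : size (a :: s) == n.+2 by rewrite /= sn.
have sn2 : size s == n.+1 by rewrite sn.
rewrite ext_consE // -[a :: s]/(tval (Tuple sn1)) ce_bdE big_ord_recl /=.
have -> : wedge n.+1 s = wedge n.+1 (Tuple sn2) by [].
rewrite ce_bdE linear_sum -addrA -big_split /= [X in _ + X]big1 => [|i _].
  rewrite addr0 big_mkcond big_ord_recl /= add0r; apply: eq_bigr => k _.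
  rewrite /bump leq0n add1n skip2_0 /=; congr (_ *: _).
  by rewrite addn1 add0n exprS exprS mulN1r mulN1r opprK.
rewrite big_mkcond big_ord_recl /= add0r.
rewrite [X in _ + ext_cons _ X]big_mkcond linear_sum -big_split; apply: big1 => j _ /=.
rewrite /bump !leq0n !add1n ltnS add0n; case: ifP => ij; last by rewrite raddf0 addr0.
have sk : size (lie s`_i s`_j :: skip2 i j s) = n.
  by rewrite /= size_skip2 // sn //; have := ltn_ord j; lia.
rewrite skip2_S linearZ /= (ext_consE _ sk) (@wedge_swap _ _ _ [::]) /=; last first.
  by have := ltn_ord j; lia.
have -> : (i.+1 + j.+1 + 1 = (i + j + 1).+2)%N by lia.
by rewrite !exprS !mulN1r opprK scalerN addNr.
Qed.

HB.instance Definition _ n a := GRing.isLinear.Build K (ext n g) (ext n g) *:%R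
  (@lie_deriv n a) (@lie_deriv_linear n a).

Lemma lie_deriv_cons n a b (u : ext n g) :
  lie_deriv a (ext_cons b u) = ext_cons b (lie_deriv a u) + ext_cons (lie a b) u.
Proof.
move: u; apply: ext_eq => [||s sn].
- by apply: linear_comp; [exact: lie_deriv_linear|exact: ext_cons_linear].
- apply: linear_add; last exact: ext_cons_linear.
  by apply: linear_comp; [exact: ext_cons_linear|exact: lie_deriv_linear].
rewrite !ext_consE // !lie_deriv_wedge //=; last by rewrite sn.
rewrite big_ord_recl /= skip1_0 scale1r addrC linear_sum; congr (_ + _).
apply: eq_bigr => k _; rewrite linearZ /= ext_consE; last first.
  by have := ltn_ord k; rewrite /= size_skip1 sn //; lia.
rewrite /bump leq0n add1n skip1_S (@wedge_swap _ _ _ [::]) /=; last by have := ltn_ord k; lia.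
by rewrite exprS mulN1r scaleNr scalerN opprK.
Qed.

Lemma lie_deriv_bil n : bil (fun a => @lie_deriv n a).
Proof.
split=> [a x y u|a x u v]; last exact: lie_deriv_linear.
case: n u => [|n] u; first by rewrite scaler0 addr0.
have [b1 _] := ext_cons_bil g n; have [c1 _] := ext_cons_bil g n.+1.
by rewrite /lie_deriv b1 c1 (@ce_bd_linear n.+1) scalerDr addrACA.
Qed.

Lemma ce_bd_cons n a (u : ext n.+1 g) :
  ce_bd (ext_cons a u) = lie_deriv a u - ext_cons a (ce_bd u).
Proof. by rewrite /lie_deriv addrK. Qed.

Lemma ce_bd_cons0 a (u : ext 0 g) : ce_bd (ext_cons a u) = 0.
Proof.
move: u; apply: ext0_eq.
- by apply: linear_comp; [exact: ce_bd_linear|exact: ext_cons_linear].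
- exact: linear_zero.
rewrite ext_consE // -[[:: a]]/(tval [tuple a]) ce_bdE big1 // => i _.
rewrite big_pred0 // => j.
by rewrite !ord1.
Qed.

(** The representation property, by induction on the degree: moving both
    operators past [c /\ -] reduces it to the Jacobi identity. *)
Lemma lie_deriv_comm n a b (u : ext n g) :
  lie_deriv a (lie_deriv b u) - lie_deriv b (lie_deriv a u) = lie_deriv (lie a b) u.
Proof.
elim: n a b u => [|n IH] a b; first by move=> u; rewrite /lie_deriv subr0.
have lth m x := @lie_deriv_linear m x.
apply: extS_eq => [||c u].
- by apply: linear_add; [|apply: linear_opp]; apply: linear_comp; exact: lth.
- exact: lth.
rewrite !lie_deriv_cons !(linear_atD _ _ (lie_deriv_linear _)) !lie_deriv_cons.
have J : lie a (lie b c) - lie b (lie a c) = lie (lie a b) c.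
  have := lie_jacobi a b c; rewrite (lieN c a) (lieN c (lie a b)).
  have -> : lie b (- lie a c) = - lie b (lie a c).
    have := lieDr (-1) b (lie a c) 0; rewrite addr0 !scaleN1r => ->.
    by have := lieDr (-1) b 0 0; rewrite scaler0 addr0 scaleN1r addNr => ->; rewrite addr0.
  by move=> /eqP; rewrite subr_eq0 => /eqP.
rewrite -IH (linear_atB _ _ (ext_cons_linear c)) -J (bilBl _ _ _ (ext_cons_bil g n)).
set P := ext_cons (lie a c) _; set Q := ext_cons (lie b c) _.
exact: addr_cross.
Qed.

(** With [u = b /\ v], moving [d] and [L_a] past [b /\ -] leaves the commutator of
    [L_a] and [L_b], which [lie_deriv_comm] identifies with [L_[a, b]]. *)
Lemma ce_bd_lie_deriv n a (u : ext n.+1 g) :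
  ce_bd (lie_deriv a u) = lie_deriv a (ce_bd u).
Proof.
elim: n a u => [|n IH] a; apply: extS_eq => [||b u];
  try by apply: linear_comp; first [exact: ce_bd_linear|exact: lie_deriv_linear].
  by rewrite lie_deriv_cons (linear_atD _ _ (@ce_bd_linear _)) !ce_bd_cons0 addr0.
rewrite lie_deriv_cons (linear_atD _ _ (@ce_bd_linear _)) !ce_bd_cons.
rewrite (linear_atB _ _ (lie_deriv_linear _)) lie_deriv_cons -lie_deriv_comm IH.
exact: addr_cancel_cross.
Qed.

(** By Cartan's formula [d d (a /\ u) = d (L_a u) - L_a (d u) + a /\ d (d u)], and
    [d] commutes with [L_a]. *)
Lemma ce_bd_sq n (u : ext n.+2 g) : ce_bd (ce_bd u) = 0.
Proof.
elim: n u => [|n IH]; apply: extS_eq => [||b u]; try exact: linear_zero;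
  try by apply: linear_comp; exact: ce_bd_linear.
  rewrite ce_bd_cons (linear_atB _ _ (@ce_bd_linear _)) ce_bd_lie_deriv ce_bd_cons0.
  by rewrite subr0.
rewrite ce_bd_cons (linear_atB _ _ (@ce_bd_linear _)) ce_bd_lie_deriv ce_bd_cons.
by rewrite IH (linear_at0 (ext_cons_linear _)) subr0 subrr.
Qed.
End LieDerivative.

(** * Functoriality of the Chevalley-Eilenberg complex *)

Section WedgeMap.
Variables (K : fieldType) (V W : lmodType K) (f : V -> W) (lf : lin f).
Variables (n m : nat) (r1 r2 : seq W) (nm : (size r1 + n <= m)%N).

Lemma wedge_map_multilinear :
  multilinear (fun t : n.-tuple V => wedge m (r1 ++ map f t ++ r2)).
Proof.
move=> t i a u v; rewrite !upd_cat !map_cat /= lf -!catA !cat_cons !catA wedge_cons_lin //.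
rewrite size_cat size_map size_take size_tuple ltn_ord; have := ltn_ord i; lia.
Qed.

Lemma wedge_map_alternating :
  alternating (fun t : n.-tuple V => wedge m (r1 ++ map f t ++ r2)).
Proof.
move=> t i j ij tij; have [s1 [s2 [s3 [b E]]]] := tuple_dup ij tij.
rewrite E map_cat /= map_cat /= -!catA /= -catA /= catA wedge_dup //.
have := congr1 size E; rewrite size_tuple !size_cat /= size_cat /= !size_map; lia.
Qed.

Lemma elift_wedge_map (s : seq V) : size s = n ->
  elift (fun t : n.-tuple V => wedge m (r1 ++ map f t ++ r2)) (wedge n s) =
  wedge m (r1 ++ map f s ++ r2).
Proof.
move=> /eqP sn; rewrite -[s]/(tval (Tuple sn)).
exact: elift_wedge wedge_map_multilinear wedge_map_alternating _.
Qed.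
End WedgeMap.

Section ExtMap.
Variables (K : fieldType) (V W : lmodType K) (f : V -> W) (lf : lin f).

Lemma ext_map_linear n : lin (@ext_map K V W f n).
Proof. exact: elift_linear. Qed.

Lemma ext_mapE n s : size s = n -> ext_map f (wedge n s) = wedge n (map f s).
Proof.
move=> sn; have := @elift_wedge_map _ _ _ _ lf n n [::] [::] (leqnn n) s sn.
rewrite cats0 => <-; rewrite /ext_map; congr elift.
by apply/funext => t; rewrite cats0.
Qed.

Lemma ext_map_cons n a (u : ext n V) :
  ext_map f (ext_cons a u) = ext_cons (f a) (ext_map f u).
Proof.
move: u; apply: ext_eq => [||s sn].
- exact: linear_comp (@ext_map_linear n.+1) (ext_cons_linear a).
- exact: linear_comp (ext_cons_linear _) (@ext_map_linear n).
by rewrite ext_consE // !ext_mapE /= ?sn // ext_consE ?size_map.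
Qed.
End ExtMap.

Section ExtMapLie.
Variables (K : fieldType) (g h : lieAlgType K) (f : g -> h) (lf : lin f).
Hypothesis lie_f : forall a b, f (lie a b) = lie (f a) (f b).

Lemma ext_map_lie_deriv n a (u : ext n g) :
  ext_map f (lie_deriv a u) = lie_deriv (f a) (ext_map f u).
Proof.
elim: n a u => [|n IH] a; first by
  move=> u; rewrite /lie_deriv (linear_at0 (@ext_map_linear _ _ _ f _)).
apply: extS_eq => [||b u].
- exact: linear_comp (@ext_map_linear _ _ _ f n.+1) (lie_deriv_linear a).
- exact: linear_comp (lie_deriv_linear _) (@ext_map_linear _ _ _ f n.+1).
rewrite lie_deriv_cons (linear_atD _ _ (@ext_map_linear _ _ _ f _)) !ext_map_cons //.
by rewrite lie_deriv_cons IH lie_f.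
Qed.

Lemma ext_map_bd n (u : ext n.+1 g) : ce_bd (ext_map f u) = ext_map f (ce_bd u).
Proof.
elim: n u => [|n IH]; apply: extS_eq => [||b u];
  try by apply: linear_comp; first [exact: ce_bd_linear|exact: ext_map_linear].
  rewrite ext_map_cons // !ce_bd_cons0.
  by rewrite (linear_at0 (@ext_map_linear _ _ _ f _)).
rewrite ext_map_cons // !ce_bd_cons (linear_atB _ _ (@ext_map_linear _ _ _ f _)).
by rewrite ext_map_lie_deriv ext_map_cons // IH.
Qed.
End ExtMapLie.

(** * The chain map from the tensor square to the complex of the sum *)

Section ExtSum.
Variables (K : fieldType) (g : lieAlgType K).
Local Notation G n := (gtensor (ce g) (ce g) n).

Definition incl1 (a : g) : g * g := (a, 0).
Definition incl2 (b : g) : g * g := (0, b).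

Lemma incl1_linear : lin incl1.
Proof. by move=> a u v; congr pair; rewrite /= scaler0 addr0. Qed.
Lemma incl2_linear : lin incl2.
Proof. by move=> a u v; congr pair; rewrite /= scaler0 addr0. Qed.

Lemma ext_sum_linear n : lin (@ext_sum K g n).
Proof. exact: glift_linear. Qed.

(** The inner lift in [ext_sum], isolated because the outer one can only be
    evaluated once this one is known to be multilinear and alternating in [s]. *)
Let ext_sum_r n q (s : seq g) : ext q g -> ext n (g * g)%type :=
  elift (fun t : q.-tuple g => wedge n (map incl1 s ++ map incl2 t)).

Let ext_sum_rE n q s t : (size s + size t <= n)%N -> size t = q ->
  @ext_sum_r n q s (wedge q t) = wedge n (map incl1 s ++ map incl2 t).
Proof.
move=> sn tq.
have sn' : (size (map incl1 s) + q <= n)%N by rewrite size_map -tq.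
have := elift_wedge_map incl2_linear [::] sn' tq; rewrite !cats0 => <-.
by rewrite /ext_sum_r; congr elift; apply/funext => t'; rewrite cats0.
Qed.

Let ext_sum_rE2 n p q (s : p.-tuple g) (t : seq g) : (p + q == n)%N -> size t = q ->
  @ext_sum_r n q s (wedge q t) = wedge n (map incl1 s ++ map incl2 t).
Proof.
by move=> /eqP e tq; apply: ext_sum_rE; rewrite // size_tuple tq e.
Qed.

Let ext_sum_lr n p q (e : (p + q == n)%N) (v : ext q g) (s : seq g) : size s = p ->
  elift (fun s : p.-tuple g => @ext_sum_r n q s v) (wedge p s) = @ext_sum_r n q s v.
Proof.
move=> /eqP sn; rewrite -[s]/(tval (Tuple sn)).
have np : (size (Nil (g * g)) + p <= n)%N by rewrite -(eqP e) leq_addr.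
rewrite elift_wedge // {s sn}.
  move=> t i a x y; move: v; apply: ext_eq => [||w wq].
  - exact: elift_linear.
  - by apply: linear_comb; exact: elift_linear.
  rewrite !ext_sum_rE2 //.
  exact: (wedge_map_multilinear incl1_linear (map incl2 w) np).
move=> t i j ij tij; move: v; apply: (ext_eq (h := fun=> 0)) => [||w wq].
- exact: elift_linear.
- exact: linear_zero.
rewrite ext_sum_rE2 //.
exact: (wedge_map_alternating incl1 (map incl2 w) np ij tij).
Qed.

Lemma ext_sum_bil n p q (e : (p + q == n)%N) : bil (fun (u : ext p g) (v : ext q g) =>
    elift (fun s : p.-tuple g => elift (fun t : q.-tuple g =>
      wedge n (map incl1 s ++ map incl2 t)) v) u).
Proof.
split=> [a u u' v|a u v v']; first exact: elift_linear.
move: u; apply: ext_eq => [||s sp].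
- exact: elift_linear.
- by apply: linear_comb; exact: elift_linear.
have E w : elift (fun s : p.-tuple g => elift (fun t : q.-tuple g =>
    wedge n (map incl1 s ++ map incl2 t)) w) (wedge p s) = @ext_sum_r n q s w.
  exact: ext_sum_lr.
by rewrite !E; apply: elift_linear.
Qed.

Lemma ext_sumE n p q (e : (p + q == n)%N) s t : size s = p -> size t = q ->
  ext_sum (ginj e (tens (wedge p s : ce g p) (wedge q t : ce g q))) =
  wedge n (map incl1 s ++ map incl2 t).
Proof.
move=> sp tq; rewrite /ext_sum gliftE; last by move=> p1 q1 e1; apply: ext_sum_bil.
rewrite [LHS](ext_sum_lr e _ sp) ext_sum_rE //.
by rewrite sp tq (eqP e).
Qed.

Lemma ext_sum_cons1 n p q (e : (p + q == n)%N) a (u : ext p g) (v : ext q g) :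
  ext_sum (ginj (e : (p.+1 + q == n.+1)%N) (tens (ext_cons a u : ce g p.+1) (v : ce g q))) =
  ext_cons (incl1 a) (ext_sum (ginj e (tens (u : ce g p) (v : ce g q)))).
Proof.
have b m i j (d : (i + j == m)%N) := bil_lin (@ext_sum_linear m) (ginj_bil (ce g) (ce g) d).
move: v; apply: ext_eq => [||t tq].
- exact: bil_linr (b _ _ _ (e : (p.+1 + q == n.+1)%N)).
- exact: linear_comp (ext_cons_linear _) (bil_linr u (b _ _ _ e)).
move: u; apply: ext_eq => [||s sp].
- exact: linear_comp (bil_linl (wedge q t : ce g q)
    (b _ _ _ (e : (p.+1 + q == n.+1)%N))) (ext_cons_linear a).
- exact: linear_comp (ext_cons_linear _) (bil_linl (wedge q t : ce g q) (b _ _ _ e)).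
rewrite ext_consE // !ext_sumE //=; last by rewrite sp.
by rewrite ext_consE // size_cat !size_map sp tq (eqP e).
Qed.

Lemma ext_sum_cons2 n p q (e : (p + q == n)%N) b (u : ext p g) (v : ext q g) :
  ext_sum (ginj (bidegreeS e) (tens (u : ce g p) (ext_cons b v : ce g q.+1))) =
  (-1) ^+ p *: ext_cons (incl2 b) (ext_sum (ginj e (tens (u : ce g p) (v : ce g q)))).
Proof.
have B m i j (d : (i + j == m)%N) := bil_lin (@ext_sum_linear m) (ginj_bil (ce g) (ce g) d).
have lZ (U : lmodType K) (F : U -> ext n.+1 (g * g)%type) :
  lin F -> lin (fun u => (-1) ^+ p *: F u) by exact: linear_scale.
move: v; apply: ext_eq => [||t tq].
- exact: linear_comp (bil_linr u (B _ _ _ (bidegreeS e))) (ext_cons_linear b).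
- refine (lZ _ _ (linear_comp (ext_cons_linear _) (bil_linr u (B _ _ _ e)))).
move: u; apply: ext_eq => [||s sp].
- exact: (bil_linl (ext_cons b (wedge q t) : ce g q.+1) (B _ _ _ (bidegreeS e))).
- refine (lZ _ _ (linear_comp (ext_cons_linear _)
    (bil_linl (wedge q t : ce g q) (B _ _ _ e)))).
rewrite ext_consE // !ext_sumE //=; last by rewrite tq.
rewrite ext_consE; last by rewrite size_cat !size_map sp tq (eqP e).
rewrite (@wedge_move _ _ _ [::]) /=; last by rewrite size_map sp -(eqP e) ltnS leq_addr.
by rewrite size_map sp scalerA -expr2 sqrr_sign scale1r.
Qed.

Lemma ext_sum_unit q (v : ext q g) :
  ext_sum (ginj (eqxx q : (0 + q == q)%N) (tens (wedge 0 [::] : ce g 0) (v : ce g q))) =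
  ext_map incl2 v.
Proof.
have b m i j (d : (i + j == m)%N) := bil_lin (@ext_sum_linear m) (ginj_bil (ce g) (ce g) d).
move: v; apply: ext_eq => [||t tq].
- exact: bil_linr (b _ _ _ (eqxx q : (0 + q == q)%N)).
- exact: ext_map_linear.
by rewrite ext_sumE //= ext_mapE //; apply: incl2_linear.
Qed.

Let lie_incl2 a b : incl2 (lie a b) = lie (incl2 a) (incl2 b).
Proof. by congr pair; rewrite /= liexx. Qed.

Let lie_incl1 a b : incl1 (lie a b) = lie (incl1 a) (incl1 b).
Proof. by congr pair; rewrite /= liexx. Qed.

Let lie_incl12 a b : lie (incl1 a) (incl2 b) = 0.
Proof.
have l0 (x : g) : lie x 0 = 0.
  by have := lieDr (-1) x 0 0; rewrite scaler0 addr0 scaleN1r addNr.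
by congr pair; rewrite /= ?l0 // lieN l0 oppr0.
Qed.

Lemma lie_deriv_ext_map_incl2 n a (v : ext n g) :
  lie_deriv (incl1 a) (ext_map incl2 v) = 0.
Proof.
elim: n v => [//|n IH]; apply: (extS_eq (h := fun=> 0)) => [||b v].
- exact: linear_comp (lie_deriv_linear _) (@ext_map_linear _ _ _ incl2 n.+1).
- exact: linear_zero.
rewrite ext_map_cons; last exact: incl2_linear.
rewrite lie_deriv_cons IH (linear_at0 (ext_cons_linear _)) lie_incl12.
by rewrite (bil0l _ (ext_cons_bil _ _)) addr0.
Qed.

(** On [g + g], the derivation [L_(a, 0)] acts on the first factor alone,
    since [(a, 0)] brackets trivially with every [(0, b)]. *)
Lemma ext_sum_lie_deriv n p q (e : (p + q == n)%N) a (u : ext p g) (v : ext q g) :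
  ext_sum (ginj e (tens (lie_deriv a u : ce g p) (v : ce g q))) =
  lie_deriv (incl1 a) (ext_sum (ginj e (tens (u : ce g p) (v : ce g q)))).
Proof.
have B m i j (d : (i + j == m)%N) := bil_lin (@ext_sum_linear m) (ginj_bil (ce g) (ce g) d).
elim: p n e u => [|p IH] n e.
  have En := eqP e; case: n / En e => e.
  apply: ext0_eq.
  - exact: linear_comp (bil_linl (v : ce g q) (B _ _ _ e)) (lie_deriv_linear a).
  - exact: linear_comp (lie_deriv_linear _) (bil_linl (v : ce g q) (B _ _ _ e)).
  rewrite (bool_irrelevance e (eqxx q)) ext_sum_unit lie_deriv_ext_map_incl2.
  exact: bil0l _ (B _ 0 q _).
case: n e => // n e.
apply: extS_eq => [||b u].
- exact: linear_comp (bil_linl (v : ce g q) (B _ _ _ e)) (lie_deriv_linear a).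
- exact: linear_comp (lie_deriv_linear _) (bil_linl (v : ce g q) (B _ _ _ e)).
rewrite lie_deriv_cons (linear_atD _ _ (bil_linl (v : ce g q) (B _ _ _ e))).
by rewrite !ext_sum_cons1 IH lie_deriv_cons lie_incl1.
Qed.

(** By induction on the degree [p] of the left factor.  For [p = 0] the map is
    induced by the Lie morphism [incl2]; the step compares Cartan's formula for
    [a] in [g] with the one for [(a, 0)] in [g + g]. *)
Lemma ext_sum_bd n (w : G n.+1) : ext_sum (tbd w) = ce_bd (ext_sum w).
Proof.
have B m i j (d : (i + j == m)%N) := bil_lin (@ext_sum_linear m) (ginj_bil (ce g) (ce g) d).
move: w; apply: gtensor_eq => [||p q e u v].
- exact: linear_comp (@ext_sum_linear n) (@tbd_linear _ _ _ n).
- exact: linear_comp (@ce_bd_linear _ _ _) (@ext_sum_linear n.+1).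
elim: p n e u => [|p IH] n e u; rewrite tbdE (linear_atD _ _ (@ext_sum_linear n)).
  rewrite /= (linear_at0 (@ext_sum_linear n)) add0r.
  case: q v e => // q v e; have En : q = n by case: (eqP e).
  case: n / En e => e; move: u; apply: ext0_eq.
  - refine (linear_comp (@ext_sum_linear q) (bil_linl v (tbdr_bil (ce g) (ce g) e))).
  - exact: linear_comp (@ce_bd_linear _ _ _) (bil_linl v (B _ _ _ e)).
  rewrite /= scale1r (ginj_irr (bidegree_r e) (eqxx q)) (ginj_irr e (eqxx q.+1)).
  by rewrite !ext_sum_unit (ext_map_bd incl2_linear lie_incl2).
move: u; apply: extS_eq => [||a u].
- apply: linear_add; refine (linear_comp (@ext_sum_linear n) _).
    exact: (bil_linl v (tbdl_bil (ce g) (ce g) e)).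
  exact: (bil_linl v (tbdr_bil (ce g) (ce g) e)).
- exact: linear_comp (@ce_bd_linear _ _ _) (bil_linl v (B _ _ _ e)).
rewrite (ext_sum_cons1 (e : (p + q == n)%N)).
case: n e => [|n] e.
  case: p {IH} u e => // u e; case: q v e => // v e.
  rewrite ce_bd_cons0.
  rewrite -[tbdl _ _ _]/(ginj (e : (0 + 0 == 0)%N) (tens (ce_bd (ext_cons a u) : ce g 0) v)).
  rewrite ce_bd_cons0 -[tbdr _ _ _]/0 (linear_at0 (@ext_sum_linear 0)) addr0.
  exact: (bil0l v (B 0 0 0 e)).
rewrite ce_bd_cons -(IH n e) tbdE (linear_atD _ _ (@ext_sum_linear n)).
rewrite (linear_atD _ _ (ext_cons_linear _)) opprD addrA; congr (_ + _).
  rewrite -ext_sum_lie_deriv.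
  rewrite -[tbdl _ (ext_cons a u : ce g p.+1) v]/(ginj (e : (p + q == n.+1)%N)
    (tens (ce_bd (ext_cons a u) : ce g p) v)).
  case: p {IH} u e => [|p] u e.
    rewrite ce_bd_cons0 -[tbdl _ _ _]/0 (linear_at0 (@ext_sum_linear n)).
    rewrite (linear_at0 (ext_cons_linear _)) subr0.
    by rewrite /lie_deriv.
  rewrite ce_bd_cons (linear_atB _ _ (bil_linl v (B n.+1 p.+1 q e))).
  by rewrite (ext_sum_cons1 (e : (p + q == n)%N)).
case: q v e {IH} => [|q] v e.
  rewrite -![tbdr _ _ _]/0 !(linear_at0 (@ext_sum_linear _)).
  by rewrite (linear_at0 (ext_cons_linear _)) oppr0.
rewrite /tbdr !(linear_atZ _ _ (@ext_sum_linear _)) (linear_atZ _ _ (ext_cons_linear _)).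
rewrite exprS mulN1r scaleNr -ext_sum_cons1; congr (- (_ *: ext_sum _)).
exact: ginj_irr.
Qed.
End ExtSum.

(** * Inverting the isomorphism of exterior powers *)

Lemma addr_lin_cross (R : comNzRingType) (V : lmodType R) (a b : R) (x y z w : V) :
  a *: x + y + b *: (a *: z + w) = a *: (x + b *: z) + (y + b *: w).
Proof. by rewrite !scalerDr !scalerA [b * a]mulrC addrACA. Qed.

Section ExtSplit.
Variables (K : fieldType) (g : lieAlgType K).
Local Notation G n := (gtensor (ce g) (ce g) n).

(** Left multiplication by [(a, b)] on the exterior powers of [g + g], transported
    to the tensor square: [(a /\ u) (x) v + (-1)^p u (x) (b /\ v)]. *)
Definition gcons n (x : g * g) : G n -> G n.+1 :=
  glift (fun p q e (u : ce g p) (v : ce g q) =>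
    ginj (e : (p.+1 + q == n.+1)%N) (tens (ext_cons x.1 u : ce g p.+1) v) +
    (-1) ^+ p *: ginj (bidegreeS e) (tens u (ext_cons x.2 v : ce g q.+1))).

Lemma gcons_linear n x : lin (@gcons n x).
Proof. exact: glift_linear. Qed.

Lemma gconsE n x p q (e : (p + q == n)%N) (u : ce g p) (v : ce g q) :
  gcons x (ginj e (tens u v)) =
    ginj (e : (p.+1 + q == n.+1)%N) (tens (ext_cons x.1 u : ce g p.+1) v) +
    (-1) ^+ p *: ginj (bidegreeS e) (tens u (ext_cons x.2 v : ce g q.+1)).
Proof.
rewrite /gcons gliftE // => {u v e} {}p {}q e; apply: bil_add.
  refine (bil_comp (ext_cons_linear x.1) (@linear_id K (ce g q))
    (ginj_bil (ce g) (ce g) (e : (p.+1 + q == n.+1)%N))).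
refine (bil_lin (F := fun t => (-1) ^+ p *: t) _ _); first exact/linear_scale/linear_id.
refine (bil_comp (@linear_id K (ce g p)) (ext_cons_linear x.2)
  (ginj_bil (ce g) (ce g) (bidegreeS e))).
Qed.

Lemma gcons_bil n : bil (@gcons n).
Proof.
split=> [a x y w|a x u v]; last exact: gcons_linear.
move: w; apply: gtensor_eq => [||p q e u v].
- exact: gcons_linear.
- by apply: linear_comb; exact: gcons_linear.
rewrite !gconsE.
have E1 : ext_cons (a *: x + y).1 u = a *: ext_cons x.1 u + ext_cons y.1 u :> ce g p.+1.
  exact: (bil_linl u (ext_cons_bil g p)).
have E2 : ext_cons (a *: x + y).2 v = a *: ext_cons x.2 v + ext_cons y.2 v :> ce g q.+1.
  exact: (bil_linl v (ext_cons_bil g q)).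
rewrite E1 E2 (bil_linl v (ginj_bil (ce g) (ce g) (e : (p.+1 + q == n.+1)%N))).
rewrite (bil_linr u (ginj_bil (ce g) (ce g) (bidegreeS e))).
exact (addr_lin_cross a ((-1) ^+ p) _ _ _ _).
Qed.

Lemma gcons_sq n x (w : G n) : gcons x (gcons x w) = 0.
Proof.
move: w; apply: (gtensor_eq (h := fun=> 0)) => [||p q e u v].
- exact: linear_comp (gcons_linear _) (gcons_linear _).
- exact: linear_zero.
rewrite gconsE (linear_atD _ _ (gcons_linear x)) (linear_atZ _ _ (gcons_linear x)) !gconsE.
have E1 : ext_cons x.1 (ext_cons x.1 u) = 0 :> ce g p.+2 by apply: ext_cons_sq.
have E2 : ext_cons x.2 (ext_cons x.2 v) = 0 :> ce g q.+2 by apply: ext_cons_sq.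
rewrite E1 E2 (bil0l _ (ginj_bil _ _ _)) (bil0r _ (ginj_bil _ _ _)) scaler0 addr0 add0r.
rewrite exprS mulN1r scaleNr addrC; apply/eqP; rewrite subr_eq0; apply/eqP.
by congr (_ *: _); apply: ginj_irr.
Qed.

Lemma gconsC n x y (w : G n) : gcons x (gcons y w) = - gcons y (gcons x w).
Proof. exact: bil_anticomm (gcons_bil n) (gcons_bil n.+1) (@gcons_sq n). Qed.

Fixpoint gword n (s : seq (g * g)) : G n :=
  if n is n'.+1 then gcons (head 0 s) (gword n' (behead s))
  else ginj (eqxx 0%N : (0 + 0 == 0)%N) (tens (wedge 0 [::] : ce g 0) (wedge 0 [::] : ce g 0)).

Lemma gword_lin n s1 s2 a x y : (size s1 + size s2).+1 = n ->
  gword n (s1 ++ (a *: x + y) :: s2) =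
  a *: gword n (s1 ++ x :: s2) + gword n (s1 ++ y :: s2).
Proof.
elim: s1 n => [|c s1 IH] [|n] //= [sn].
  exact (bil_linl (gword n s2) (gcons_bil n) a x y).
by rewrite (IH n sn); exact (@gcons_linear n c a _ _).
Qed.

Lemma gword_dup n s1 s2 s3 x : (size s1 + size s2 + size s3).+2 = n ->
  gword n (s1 ++ x :: s2 ++ x :: s3) = 0.
Proof.
elim: s1 n => [|c s1 IH] [|n] //= [sn]; last first.
  by rewrite IH // (linear_at0 (gcons_linear _)).
elim: s2 n sn => [|c s2 IH] [|n] //= [sn]; first exact: gcons_sq.
by rewrite gconsC IH // (linear_at0 (gcons_linear _)) oppr0.
Qed.

(** The universal property of the exterior power applies because the operators
    [gcons x] are linear in [x] and square to zero. *)
Definition ext_split n : ext n (g * g)%type -> G n :=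
  elift (fun t : n.-tuple (g * g)%type => gword n t).

Lemma ext_split_linear n : lin (@ext_split n).
Proof. exact: elift_linear. Qed.

Lemma ext_splitE n s : size s = n -> ext_split (wedge n s) = gword n s.
Proof.
move=> /eqP sn; rewrite -[s]/(tval (Tuple sn)) /ext_split elift_wedge //.
  move=> t i a u v; rewrite !upd_cat gword_lin //.
  rewrite size_take size_drop size_tuple ltn_ord; have := ltn_ord i; lia.
move=> t i j ij tij; have [s1 [s2 [s3 [b E]]]] := tuple_dup ij tij.
rewrite E gword_dup //.
have := congr1 size E; rewrite size_tuple !size_cat /= size_cat /=; lia.
Qed.

Lemma ext_split_cons n x (u : ext n (g * g)%type) :
  ext_split (ext_cons x u) = gcons x (ext_split u).
Proof.
move: u; apply: ext_eq => [||s sn].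
- exact: linear_comp (@ext_split_linear n.+1) (ext_cons_linear x).
- exact: linear_comp (gcons_linear x) (@ext_split_linear n).
by rewrite ext_consE // !ext_splitE //= sn.
Qed.

Lemma gword_cat n p q (e : (p + q == n)%N) s t : size s = p -> size t = q ->
  gword n (map (@incl1 K g) s ++ map (@incl2 K g) t) =
  ginj e (tens (wedge p s : ce g p) (wedge q t : ce g q)).
Proof.
elim: s n p e => [|a s IH] n p e sp tq.
  rewrite -{p}sp in e *; move: (eqP e); rewrite add0n => En; case: n / En e => e /=.
  elim: t q tq e => [|b t IH] q <- e /=; first exact: ginj_irr.
  rewrite (IH _ erefl (eqxx _)) gconsE /= expr0 scale1r.
  rewrite (bil0l _ (ext_cons_bil _ _)) (bil0l _ (ginj_bil (ce g) (ce g) _)) add0r ext_consE //.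
  exact: ginj_irr.
case: p sp e => // p [sp]; case: n => // n e /=.
rewrite (IH n p (e : (p + q == n)%N) sp tq) gconsE /= (ext_consE a sp).
rewrite (bil0l _ (ext_cons_bil _ _)).
by rewrite (bil0r _ (ginj_bil (ce g) (ce g) _)) scaler0 addr0.
Qed.

Lemma ext_sumK n : cancel (@ext_sum K g n) (@ext_split n).
Proof.
apply: gtensor_eq => [||p q e u v].
- exact: linear_comp (@ext_split_linear n) (@ext_sum_linear _ _ n).
- exact: linear_id.
have B := bil_lin (linear_comp (@ext_split_linear n) (@ext_sum_linear _ _ n))
  (ginj_bil (ce g) (ce g) e).
have B' := ginj_bil (ce g) (ce g) e.
move: u; apply: ext_eq => [||s sp].
- exact: bil_linl v B.
- exact: bil_linl v B'.
move: v; apply: ext_eq => [||t tq].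
- exact: bil_linr (wedge p s : ce g p) B.
- exact: bil_linr (wedge p s : ce g p) B'.
rewrite ext_sumE // ext_splitE; last by rewrite size_cat !size_map sp tq (eqP e).
exact: gword_cat.
Qed.

Lemma ext_sum_gcons n x (w : G n) : ext_sum (gcons x w) = ext_cons x (ext_sum w).
Proof.
move: w; apply: gtensor_eq => [||p q e u v].
- exact: linear_comp (@ext_sum_linear _ _ n.+1) (gcons_linear x).
- exact: linear_comp (ext_cons_linear x) (@ext_sum_linear _ _ n).
rewrite gconsE (linear_atD _ _ (@ext_sum_linear _ _ _)) (linear_atZ _ _ (@ext_sum_linear _ _ _)).
rewrite ext_sum_cons1 ext_sum_cons2 scalerA -expr2 sqrr_sign scale1r.
rewrite -(linear_atD _ _ (bil_linl _ (ext_cons_bil _ n))); congr ext_cons.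
by case: x => a b; congr pair; rewrite /= ?addr0 ?add0r.
Qed.

Lemma ext_splitK n : cancel (@ext_split n) (@ext_sum K g n).
Proof.
elim: n => [|n IH].
  apply: ext0_eq.
  - exact: linear_comp (@ext_sum_linear _ _ 0) (@ext_split_linear 0).
  - exact: linear_id.
  by rewrite ext_splitE //= ext_sumE.
apply: extS_eq => [||x u].
- exact: linear_comp (@ext_sum_linear _ _ n.+1) (@ext_split_linear n.+1).
- exact: linear_id.
by rewrite ext_split_cons ext_sum_gcons IH.
Qed.

Lemma inv_of_ext_sum n : inv_of (@ext_sum K g n) = @ext_split n.
Proof.
apply/funext => y; rewrite /inv_of.
have /(xgetPex 0) H : exists w, ext_sum w = y by exists (ext_split y); apply: ext_splitK.
by rewrite -[LHS]ext_sumK H.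
Qed.

Lemma ext_split_bd n (u : ext n.+1 (g * g)%type) :
  tbd (ext_split u) = ext_split (ce_bd u).
Proof. by rewrite -{2}[u]ext_splitK -ext_sum_bd ext_sumK. Qed.
End ExtSplit.

(** * Sums over iterated coproducts *)

Section SweedlerTheory.
Variables (K : fieldType) (C : cocommCoalgType K).

Lemma sweedler_linear (U : lmodType K) (f : C -> C -> U) : lin (sweedler f).
Proof. by move=> a x y; rewrite /sweedler !linearP. Qed.

Lemma sweedler_ext (U : lmodType K) (f h : C -> C -> U) x :
  (forall y z, f y z = h y z) -> sweedler f x = sweedler h x.
Proof. by move=> fh; congr sweedler; apply/funext => y; apply/funext => z. Qed.

Lemma lin_sweedler (U U' : lmodType K) (H : U -> U') (f : C -> C -> U) x :
  lin H -> bil f -> H (sweedler f x) = sweedler (fun y z => H (f y z)) x.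
Proof.
move=> lH bf; rewrite /sweedler; move: (comul x); apply: tens_eq => [||y z].
- by apply: linear_comp => //; exact: linearP.
- exact: linearP.
by rewrite !tliftE //; apply: bil_lin.
Qed.

Lemma sweedler_comb (U : lmodType K) (f h : C -> C -> U) a x : bil f -> bil h ->
  sweedler (fun y z => a *: f y z + h y z) x = a *: sweedler f x + sweedler h x.
Proof. exact: tlift_comb. Qed.

Lemma sweedler_add (U : lmodType K) (f h : C -> C -> U) x : bil f -> bil h ->
  sweedler (fun y z => f y z + h y z) x = sweedler f x + sweedler h x.
Proof.
move=> bf bh; rewrite -[sweedler f x]scale1r -sweedler_comb //.
by apply: sweedler_ext => y z; rewrite scale1r.
Qed.

Lemma sweedler0 (U : lmodType K) x : sweedler (fun _ _ : C => 0 : U) x = 0.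
Proof.
rewrite /sweedler; move: (comul x); apply: (tens_eq (h := fun=> 0)) => [||y z].
- exact: linearP.
- exact: linear_zero.
by rewrite tliftE //; apply: bil_zero.
Qed.

Lemma sweedler_param_linear (V U : lmodType K) (F : V -> C -> C -> U) x :
  (forall v, bil (F v)) -> (forall y z, lin (fun v => F v y z)) ->
  lin (fun v => sweedler (F v) x).
Proof.
move=> bF lF a u v; rewrite -sweedler_comb //.
by apply: sweedler_ext => y z; apply: lF.
Qed.

Definition trilin (U : lmodType K) (h : C -> C -> C -> U) :=
  (forall y, bil (h y)) /\ (forall z, bil (fun y y' => h y y' z)).

(** Of the two equal ways to iterate the coproduct, the one that splits the right
    factor; [sweedler3A] relates it to the other. *)
Definition sweedler3 (U : lmodType K) (h : C -> C -> C -> U) (x : C) : U :=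
  sweedler (fun y z => sweedler (h y) z) x.

Lemma sweedler3_bil (U : lmodType K) (h : C -> C -> C -> U) : trilin h ->
  bil (fun y z => sweedler (h y) z).
Proof.
move=> [h1 h2]; split=> [a y y' z|a y z z']; last exact: sweedler_linear.
by rewrite -sweedler_comb //; apply: sweedler_ext => u v; case: (h2 v) => H _; apply: H.
Qed.

Lemma sweedler3A (U : lmodType K) (h : C -> C -> C -> U) x : trilin h ->
  sweedler (fun y z => sweedler (fun y1 y2 => h y1 y2 z) y) x = sweedler3 h x.
Proof. by move=> [h1 h2]; rewrite /sweedler3 /sweedler sw_tri. Qed.

Lemma trilin_swap (U : lmodType K) (h : C -> C -> C -> U) :
  trilin h -> trilin (fun y y' z => h y' y z).
Proof.
move=> [h1 h2]; split=> [y|z].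
  split=> [a u v z|a u z z']; first by case: (h2 z) => H _; apply: H.
  by case: (h1 u) => _ H; apply: H.
by split=> [a u v w|a u v w]; case: (h2 z) => H1 H2; [apply: H2|apply: H1].
Qed.

Lemma sweedler3C (U : lmodType K) (h : C -> C -> C -> U) x : trilin h ->
  sweedler3 (fun y y' z => h y' y z) x = sweedler3 h x.
Proof.
move=> th; have th' := trilin_swap th; have [h1 h2] := th.
rewrite -!sweedler3A //; apply: sweedler_ext => y z.
by rewrite /sweedler (tlift_swap (h := fun y y' => h y y' z)).
Qed.

Lemma sweedler3_add (U : lmodType K) (h k : C -> C -> C -> U) x : trilin h -> trilin k ->
  sweedler3 (fun y y' z => h y y' z + k y y' z) x = sweedler3 h x + sweedler3 k x.
Proof.
move=> th tk; rewrite /sweedler3 -sweedler_add; try exact: sweedler3_bil.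
by apply: sweedler_ext => y z; apply: sweedler_add; [case: th|case: tk].
Qed.

Lemma sweedler3_swap_add (U : lmodType K) (h k : C -> C -> C -> U) x :
  trilin h -> trilin k -> sweedler3 h x + sweedler3 k x =
  sweedler3 (fun y y' z => h y' y z + k y y' z) x.
Proof.
move=> th tk; rewrite -(sweedler3C x th).
by rewrite (sweedler3_add x (trilin_swap th) tk).
Qed.

Lemma lin_sweedlern (U U' : lmodType K) (H : U -> U') n (f : seq C -> U) x :
  lin H -> mlin n f -> H (sweedlern n f x) = sweedlern n (fun s => H (f s)) x.
Proof.
move=> lH; elim: n f x => [|n IH] f x mf /=; first by rewrite (linear_atZ _ _ lH).
rewrite (lin_sweedler _ lH (sw_bil mf)); apply: sweedler_ext => y z.
by apply: IH; apply: mlin_cons.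
Qed.

Lemma gmap_bil (V V' W W' : nat -> lmodType K) (f : C -> forall n, V n -> V' n)
    (g : C -> forall n, W n -> W' n) n (w : gtensor V W n) :
  (forall n, bil (fun x => f x n)) -> (forall n, bil (fun x => g x n)) ->
  bil (fun x y => gmap (f x) (g y) w).
Proof.
move=> bf bg.
have lf x m := bil_linr x (bf m); have lg x m := bil_linr x (bg m).
split=> a x y z; move: w; apply: gtensor_eq => [||p q e u v];
  try exact: gmap_linear; try by (apply: linear_comb; exact: gmap_linear).
- rewrite !gmapE // (bil_linl u (bf p)).
  exact: bil_linl _ (ginj_bil V' W' e) _ _ _.
- rewrite !gmapE // (bil_linl v (bg q)).
  exact: bil_linr _ (ginj_bil V' W' e) _ _ _.
Qed.
End SweedlerTheory.

(** * The chain map of a measuring *)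

Section Measuring.
Variables (K : fieldType) (g g' : lieAlgType K) (C : cocommCoalgType K).
Variables (Psi : C -> {linear g -> g'}) (mP : measuring Psi).
Hypothesis K2 : (2%:R : K) != 0.

Local Notation M := (ce_measuring Psi).

Lemma ce_measuring_linear x n : lin (@ce_measuring K g g' C Psi x n).
Proof. exact: elift_linear. Qed.

Let word (t : seq g) n (s : seq C) : ext n g' :=
  wedge n [seq Psi ya.1 ya.2 | ya <- zip s t].

Let word_mlin n t : size t = n -> mlin n (word t n).
Proof.
move=> tn s1 s2 a u v E; rewrite /word.
have i : (size s1 < size t)%N by lia.
rewrite -(cat_take_drop (size s1) t) (drop_nth 0 i).
have st : size s1 = size (take (size s1) t) by rewrite size_take i.
rewrite !zip_cat // !map_cat /= (measuring_linear mP) wedge_cons_lin //.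
by rewrite size_map size_zip -st minnn -tn.
Qed.

Lemma ce_measuring_wedge x n t : size t = n ->
  M x (wedge n t : ce g n) = sweedlern n (word t n) x.
Proof. by move=> /eqP tn; rewrite -[t]/(tval (Tuple tn)); apply: ce_measuringE. Qed.

Lemma ce_measuring_bil n : bil (fun x (u : ce g n) => M x u : ce g' n).
Proof.
split=> [a x y u|a x u v]; last exact: ce_measuring_linear.
move: u; apply: ext_eq => [||s sn].
- exact: ce_measuring_linear.
- by apply: linear_comb; exact: ce_measuring_linear.
by rewrite !ce_measuring_wedge //; apply: sw_lin.
Qed.

Lemma measuring_linearl a : lin (fun y => Psi y a).
Proof. by move=> b x y; apply: (measuring_linear mP). Qed.

Lemma cons_measuring_bil n a (u : ce g n) :
  bil (fun y z => ext_cons (Psi y a) (M z u) : ce g' n.+1).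
Proof.
refine (bil_comp (measuring_linearl a) (bil_linl u (ce_measuring_bil n)) (ext_cons_bil g' n)).
Qed.

Lemma lie_deriv_measuring_bil n a (u : ce g n) :
  bil (fun y z => lie_deriv (Psi y a) (M z u) : ce g' n).
Proof.
refine (bil_comp (measuring_linearl a) (bil_linl u (ce_measuring_bil n)) (lie_deriv_bil g' n)).
Qed.

Lemma ce_measuring_cons n x a (u : ce g n) :
  M x (ext_cons a u : ce g n.+1) = sweedler (fun y z => ext_cons (Psi y a) (M z u) : ce g' n.+1) x.
Proof.
move: u; apply: ext_eq => [||s sn].
- exact: linear_comp (@ce_measuring_linear x n.+1) (ext_cons_linear a).
- apply: sweedler_param_linear => [u|y z]; first exact: cons_measuring_bil.
  exact: linear_comp (ext_cons_linear _) (@ce_measuring_linear z n).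
rewrite ext_consE // ce_measuring_wedge /= ?sn //; apply: sweedler_ext => y z.
rewrite ce_measuring_wedge // (lin_sweedlern _ (ext_cons_linear _) (word_mlin sn)).
apply: sw_ext => r rn; rewrite /word /= ext_consE // size_map size_zip rn sn; exact: minnn.
Qed.

Lemma lie_measuring_bil a b : bil (fun y y' => lie (Psi y a) (Psi y' b)).
Proof.
by split=> *; rewrite (measuring_linear mP); [apply: lieDl|apply: lieDr].
Qed.

(** The measuring condition and cocommutativity: on [b /\ w] the derivation
    property turns both sides into the same two sums over [x_(1), x_(2), x_(3)], one
    of them after exchanging [x_(1)] and [x_(2)]. *)
Lemma ce_measuring_lie_deriv n x a (u : ce g n) :
  M x (lie_deriv a u : ce g n) = sweedler (fun y z => lie_deriv (Psi y a) (M z u) : ce g' n) x.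
Proof.
elim: n x u => [|n IH] x.
  move=> u; rewrite /lie_deriv sweedler0; exact: linear_at0 (@ce_measuring_linear x 0).
apply: extS_eq => [||b w].
- exact: linear_comp (@ce_measuring_linear x n.+1) (lie_deriv_linear a).
- apply: sweedler_param_linear => [u|y z]; first exact: lie_deriv_measuring_bil.
  exact: linear_comp (lie_deriv_linear _) (@ce_measuring_linear z n.+1).
pose h y y' z : ce g' n.+1 := ext_cons (Psi y b) (lie_deriv (Psi y' a) (M z w)).
pose k y y' z : ce g' n.+1 := ext_cons (lie (Psi y a) (Psi y' b)) (M z w).
have th : trilin h.
  split=> [y|z]; first exact: bil_lin (ext_cons_linear (Psi y b)) (lie_deriv_measuring_bil a w).
  refine (bil_comp (measuring_linearl b) 
    (linear_comp (f := fun a => lie_deriv a (M z w)) _ (measuring_linearl a))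
    (ext_cons_bil g' n)).
  exact: (bil_linl (M z w) (lie_deriv_bil g' n)).
have tk : trilin k.
  split=> [y|z]; last exact: bil_lin (bil_linl (M z w) (ext_cons_bil g' n)) (lie_measuring_bil a b).
  refine (bil_comp (bil_linr y (lie_measuring_bil a b)) (bil_linl w (ce_measuring_bil n))
    (ext_cons_bil g' n)).
transitivity (sweedler3 h x + sweedler3 k x).
  rewrite (lie_deriv_cons a b w) (linear_atD _ _ (@ce_measuring_linear x n.+1)).
  congr (_ + _); rewrite [LHS]ce_measuring_cons.
    apply: sweedler_ext => y z.
    by rewrite IH (lin_sweedler _ (ext_cons_linear _) (lie_deriv_measuring_bil a w)).
  rewrite -sweedler3A //; apply: sweedler_ext => y z.
  rewrite (measuring_lie mP).
  exact: (lin_sweedler _ (bil_linl (M z w) (ext_cons_bil g' n)) (lie_measuring_bil a b)).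
rewrite (sweedler3_swap_add x th tk).
apply: sweedler_ext => y z.
rewrite ce_measuring_cons (lin_sweedler _ (lie_deriv_linear _) (cons_measuring_bil b w)).
by apply: sweedler_ext => y' z'; rewrite lie_deriv_cons.
Qed.

Lemma ce_measuring_bd n x (u : ext n.+1 g) : ce_bd (M x u) = M x (ce_bd u).
Proof.
elim: n x u => [|n IH] x; apply: extS_eq => [||a w];
  try (exact: linear_comp (@ce_bd_linear _ _ _) (@ce_measuring_linear x _));
  try (exact: linear_comp (@ce_measuring_linear x _) (@ce_bd_linear _ _ _)).
  rewrite ce_measuring_cons ce_bd_cons0.
  rewrite (lin_sweedler _ (@ce_bd_linear _ g' 0) (cons_measuring_bil a w)).
  rewrite (linear_at0 (@ce_measuring_linear x 0)) -[RHS](sweedler0 (ce g' 0) x).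
  by apply: sweedler_ext => y z; rewrite ce_bd_cons0.
rewrite ce_measuring_cons ce_bd_cons.
rewrite (lin_sweedler _ (@ce_bd_linear _ g' _) (cons_measuring_bil a w)).
rewrite (linear_atB _ _ (@ce_measuring_linear x _)) ce_measuring_lie_deriv ce_measuring_cons.
rewrite addrC -scaleN1r -sweedler_comb;
  [|exact: cons_measuring_bil|exact: lie_deriv_measuring_bil].
by apply: sweedler_ext => y z; rewrite ce_bd_cons IH scaleN1r addrC.
Qed.

Local Notation G h n := (gtensor (ce h) (ce h) n).

(** The two-factor analogue of [ce_measuring_cons].  On [u (x) v] each of the two
    summands of [gcons] splits one factor of the coproduct of [x] once more; the
    sums agree after reassociating in the first and exchanging in the second. *)
Lemma gmap_measuring_gcons n x a (w : G g n) :
  sweedler (fun y z => gmap (M y) (M z) (gcons (a, a) w)) x =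
  sweedler (fun y z => gcons (Psi y a, Psi y a)
    (sweedler (fun y' z' => gmap (M y') (M z') w) z)) x.
Proof.
have ml y m := @ce_measuring_linear y m.
have gb m (w : G g m) := gmap_bil w (fun m => ce_measuring_bil m) (fun m => ce_measuring_bil m).
have diag_linear : lin (fun y => (Psi y a, Psi y a)).
  by move=> b y z; congr pair; apply: measuring_linearl.
have gl m y z := @gmap_linear _ _ _ _ _ (M y) (M z) m.
have sl m z (y : C) : lin (fun w : G g m => sweedler (fun y' z' => gmap (M y') (M z') w) z).
  by apply: sweedler_param_linear => // *; apply: gmap_linear.
move: w; apply: gtensor_eq => [||p q e u v].
- apply: sweedler_param_linear => [w|y z]; first exact: gb.
  exact: linear_comp (gl _ y z) (gcons_linear _).
- apply: sweedler_param_linear => [w|y z].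
    refine (bil_comp (k := fun z => sweedler (fun y' z' => gmap (M y') (M z') w) z)
      diag_linear _ (gcons_bil g' n)).
    exact: sweedler_linear.
  exact: linear_comp (gcons_linear _) (sl _ z y).
pose bG m i j (d : (i + j == m)%N) := ginj_bil (ce g') (ce g') d.
pose h y y' z : G g' n.+1 := ginj (e : (p.+1 + q == n.+1)%N)
  (tens (ext_cons (Psi y a) (M y' u) : ce g' p.+1) (M z v)).
pose k y y' z : G g' n.+1 := (-1) ^+ p *: ginj (bidegreeS e)
  (tens (M y' u) (ext_cons (Psi y a) (M z v) : ce g' q.+1)).
have Mu := bil_linl u (ce_measuring_bil p); have Mv := bil_linl v (ce_measuring_bil q).
have th : trilin h.
  split=> [y|z].
    refine (bil_comp (linear_comp (ext_cons_linear (Psi y a)) Mu) Mv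
      (bG _ _ _ (e : (p.+1 + q == n.+1)%N))).
  refine (bil_lin (bil_linl (M z v) (bG _ _ _ (e : (p.+1 + q == n.+1)%N)))
    (cons_measuring_bil a u)).
have sgn : lin (fun t : G g' n.+1 => (-1) ^+ p *: t) by exact/linear_scale/linear_id.
have tk : trilin k.
  split=> [y|z]; refine (bil_lin sgn _).
    refine (bil_comp Mu (linear_comp (ext_cons_linear (Psi y a)) Mv)
      (bG _ _ _ (bidegreeS e))).
  refine (bil_flip (bil_comp Mu
    (linear_comp (bil_linl (M z v) (ext_cons_bil g' q)) (measuring_linearl a))
    (bG _ _ _ (bidegreeS e)))).
transitivity (sweedler3 h x + sweedler3 k x).
  pose A y z : G g' n.+1 := ginj (e : (p.+1 + q == n.+1)%N)
    (tens (M y (ext_cons a u) : ce g' p.+1) (M z v)).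
  pose B y z : G g' n.+1 := (-1) ^+ p *: ginj (bidegreeS e)
    (tens (M y u) (M z (ext_cons a v) : ce g' q.+1)).
  transitivity (sweedler (fun y z => A y z + B y z) x).
    apply: sweedler_ext => y z.
    rewrite gconsE (linear_atD _ _ (gl _ y z)) (linear_atZ _ _ (gl _ y z)).
    by rewrite !(gmapE (ml y) (ml z)).
  rewrite sweedler_add; last first.
  - refine (bil_lin sgn (bil_comp Mu
      (bil_linl (ext_cons a v : ce g q.+1) (ce_measuring_bil q.+1)) (bG _ _ _ (bidegreeS e)))).
  - refine (bil_comp (bil_linl (ext_cons a u : ce g p.+1) (ce_measuring_bil p.+1)) Mv
      (bG _ _ _ (e : (p.+1 + q == n.+1)%N))).
  congr (_ + _).
    rewrite -(sweedler3A x th); apply: sweedler_ext => y z.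
    rewrite /A (ce_measuring_cons y a u).
    exact: (lin_sweedler _ (bil_linl (M z v) (bG _ _ _ (e : (p.+1 + q == n.+1)%N)))
      (cons_measuring_bil a u)).
  rewrite -(sweedler3C x tk); apply: sweedler_ext => y z.
  rewrite /B (ce_measuring_cons z a v).
  exact: (lin_sweedler _ (linear_comp sgn (bil_linr (M y u) (bG _ _ _ (bidegreeS e))))
    (cons_measuring_bil a v)).
rewrite -(sweedler3_add x th tk); apply: sweedler_ext => y z.
rewrite (lin_sweedler _ (gcons_linear _) (gb _ _)); apply: sweedler_ext => y' z'.
by rewrite (gmapE (ml y') (ml z')) gconsE.
Qed.

End Measuring.

(** * The coproduct on chains and in homology *)

Section Coproduct.
Variables (K : fieldType) (g : lieAlgType K).
Local Notation G n := (gtensor (ce g) (ce g) n).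
Local Notation T := (tensor_complex (ce g) (ce g)).

Definition diag (a : g) : g * g := (a, a).

Lemma diag_linear : lin diag. Proof. by []. Qed.

Definition ce_coprod n (u : ext n g) : G n := ext_split (ext_map diag u).

Lemma ce_coprod_linear n : lin (@ce_coprod n).
Proof. exact: linear_comp (@ext_split_linear _ _ n) (@ext_map_linear _ _ _ diag n). Qed.

Lemma ce_coprod_cons n a (u : ext n g) :
  ce_coprod (ext_cons a u) = gcons (a, a) (ce_coprod u).
Proof. by rewrite /ce_coprod (ext_map_cons diag_linear) ext_split_cons. Qed.

Lemma ce_bd_cycle n (u : ce g n.+1) : is_cycle (bd (ce g) n u).
Proof. by case: n u => // n u; apply/eqP; apply: ce_bd_sq. Qed.

(** Both inverses in the definition of the coproduct are of bijections: that of
    [ext_sum] is [ext_split], and a Kunneth preimage exists by [kunneth_surj]. *)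
Lemma homology_coprodE n (z : ce g n) : is_cycle z ->
  is_cycle (ce_coprod z : T n) /\
  kunneth (homology_coprod (hclass z)) = hclass (ce_coprod z : T n).
Proof.
move=> cz; rewrite /homology_coprod.
have [cd dE] := hmapE (C := ce g) (D := ce (g * g)%type) (f := fun m => @ext_map K g _ diag m)
  (@ext_map_linear _ _ _ diag) (@ext_map_bd _ _ _ diag diag_linear (fun a b => erefl)) cz.
have [cs sE] := hmapE (C := ce (g * g)%type) (D := T) (f := @ext_split K g)
  (@ext_split_linear _ g) (@ext_split_bd _ g) cd.
split=> //.
rewrite [X in hmap _ X]dE.
have -> : (fun m => inv_of (@ext_sum K g m)) = @ext_split K g.
  by apply: functional_extensionality_dep => m; apply: inv_of_ext_sum.
rewrite [X in inv_of _ X]sE.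
rewrite /inv_of.
apply: (xgetPex 0 (P := [set w | kunneth w = hclass (ce_coprod z : T n)]%classic)).
exists (gmap (@hproj K _) (@hproj K _) (ce_coprod z)).
refine (kunneth_surj (C := ce g) (D := ce g) ce_bd_cycle ce_bd_cycle cs).
Qed.
End Coproduct.

(** * Naturality of the coproduct *)

Section Naturality.
Variables (K : fieldType) (g g' : lieAlgType K) (C : cocommCoalgType K).
Variables (Psi : C -> {linear g -> g'}) (mP : measuring Psi).
Hypothesis K2 : (2%:R : K) != 0.
Local Notation M := (ce_measuring Psi).

(** In degree 0 this is the counit axiom, since [M x 1 = counit x]; the inductive
    step is [gmap_measuring_gcons]. *)
Lemma ce_coprod_measuring n x (u : ext n g) :
  ce_coprod (M x u) = sweedler (fun y z => gmap (M y) (M z) (ce_coprod u)) x.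
Proof.
have gb m (w : gtensor (ce g) (ce g) m) :=
  gmap_bil w (fun m => ce_measuring_bil mP K2 m) (fun m => ce_measuring_bil mP K2 m).
have ml y m := @ce_measuring_linear _ _ _ _ Psi y m.
have linS m v : lin (fun u => sweedler (fun y z => gmap (M y) (M z) (@ce_coprod K g m u)) v).
  apply: sweedler_param_linear => [w|y z]; first exact: gb.
  exact: linear_comp (gmap_linear _ _ (n := m)) (@ce_coprod_linear _ g m).
elim: n x u => [|n IH] x.
  apply: ext0_eq; [exact: linear_comp (@ce_coprod_linear _ g' 0) (ml x 0)|exact: linS|].
  have one (h : lieAlgType K) : ce_coprod (wedge 0 [::] : ce h 0) =
      ginj (eqxx 0%N : (0 + 0 == 0)%N) (tens (wedge 0 [::] : ce h 0) (wedge 0 [::] : ce h 0)).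
    by rewrite /ce_coprod (ext_mapE (@diag_linear _ h)) // ext_splitE.
  have M1 y : M y (wedge 0 [::] : ce g 0) = counit y *: (wedge 0 [::] : ce g' 0).
    by rewrite (ce_measuring_wedge mP K2).
  rewrite M1 (linear_atZ _ _ (@ce_coprod_linear _ g' 0)) !one.
  have B := ginj_bil (ce g') (ce g') (eqxx 0%N : (0 + 0 == 0)%N).
  have eE y z : gmap (M y) (M z) (ginj (eqxx 0%N : (0 + 0 == 0)%N)
      (tens (wedge 0 [::] : ce g 0) (wedge 0 [::] : ce g 0))) =
      counit (counit y *: z) *: ginj (eqxx 0%N : (0 + 0 == 0)%N)
      (tens (wedge 0 [::] : ce g' 0) (wedge 0 [::] : ce g' 0)).
    rewrite (gmapE (ml y) (ml z)) !M1 (linear_atZ _ _ (bil_linl _ B)).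
    rewrite (linear_atZ _ _ (bil_linr _ B)).
    by rewrite scalerA linearZ.
  rewrite (sweedler_ext x eE); set e := ginj _ _.
  have le : lin (fun y : C => counit y *: e).
    by move=> a y z; rewrite linearP scalerDl scalerA.
  rewrite -[in LHS](counitl x) (lin_sweedler x le) //.
  by split=> [a y y' z|a y z z']; rewrite ?linearP ?scalerDl ?scalerDr !scalerA // mulrC.
apply: extS_eq => [||a u]; [|exact: linS|].
  exact: linear_comp (@ce_coprod_linear _ g' n.+1) (ml x n.+1).
rewrite (ce_measuring_cons mP K2).
rewrite (lin_sweedler _ (@ce_coprod_linear _ g' n.+1) (cons_measuring_bil mP K2 a u)).
rewrite ce_coprod_cons (gmap_measuring_gcons mP K2); apply: sweedler_ext => y z.
by rewrite ce_coprod_cons IH.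
Qed.

Lemma homology_measuring_bil n :
  bil (fun x (h : homology (ce g) n) => homology_measuring Psi x h).
Proof.
have ml y m := @ce_measuring_linear _ _ _ _ Psi y m.
split=> [a x y h|a x u v]; last first.
  exact: (hmap_linear (C := ce g) (D := ce g') (ml x)
    (fun n => @ce_measuring_bd _ _ _ _ _ mP K2 n x)).
have [cz <-] := hclassP h.
have E v := hmapE (C := ce g) (D := ce g') (ml v)
  (fun n => @ce_measuring_bd _ _ _ _ _ mP K2 n v) cz.
rewrite /homology_measuring !(E _).2 (bil_linl _ (ce_measuring_bil mP K2 n)).
by rewrite (hclass_lin a (E x).1 (E y).1).
Qed.
End Naturality.

Lemma hclass_sweedler (K : fieldType) (C : cocommCoalgType K) (E : chain_complex K) n
    (F : C -> C -> E n) x : bil F -> (forall y z, is_cycle (F y z)) ->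
  is_cycle (sweedler F x) /\ hclass (sweedler F x) = sweedler (fun y z => hclass (F y z)) x.
Proof.
move=> bF cF.
have bH : bil (fun y z => hclass (F y z)).
  by split=> [a y y' z|a y z z']; rewrite -hclass_lin //; congr hclass;
    [exact: bil_linl z bF _ _ _|exact: bil_linr y bF _ _ _].
rewrite /sweedler; elim/tens_ind: (comul x) => [a y z t [ct tE]|].
  rewrite !linearP /= !tliftE //; split; first exact: is_cycle_lin.
  by rewrite hclass_lin // tE.
rewrite !raddf0; split; first exact: is_cycle0.
by apply/hclass_eq0; [exact: is_cycle0|exists 0; rewrite raddf0].
Qed.

Theorem proposition5p2 (K : fieldType) (charK : [pchar K] =i pred0)
    (g g' : lieAlgType K) (C : cocommCoalgType K)
    (Psi : C -> {linear g -> g'}) (Psi_measuring : measuring Psi)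
    (x : C) (n : nat) (h : homology (ce g) n) :
  homology_coprod (homology_measuring Psi x h) =
  sweedler (fun y z => gmap (homology_measuring Psi y) (homology_measuring Psi z)
                         (homology_coprod h)) x.
Proof.
(* Invertibility of 2 makes the chain map of a measuring alternating, by cocommutativity. *)
have K2 : (2%:R : K) != 0.
  by apply/negP => K2; have := charK 2%N; rewrite !inE K2.
have ml y m := @ce_measuring_linear _ _ _ _ Psi y m.
have mbd y m := @ce_measuring_bd _ _ _ _ _ Psi_measuring K2 m y.
have [cz <-] := hclassP h; move: (hrep h) cz => z cz {h}.
have [cM ME] := hmapE (C := ce g) (D := ce g') (ml x) (mbd x) cz.
have [cD DE] := homology_coprodE cz.
have [cD' DE'] := homology_coprodE cM.
(* After applying Kunneth, both sides are classes of explicit cycles. *)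
apply: (kunneth_inj (@ce_bd_cycle _ g') (@ce_bd_cycle _ g')).
rewrite [X in homology_coprod X]ME DE' (ce_coprod_measuring Psi_measuring K2).
set w := homology_coprod _.
have gb : bil (fun y z => gmap (homology_measuring Psi y) (homology_measuring Psi z) w).
  apply: gmap_bil => m; exact: homology_measuring_bil.
rewrite (lin_sweedler x (@kunneth_linear _ (ce g') (ce g') n) gb).
have gm y v := hmapE
  (C := tensor_complex (ce g) (ce g)) (D := tensor_complex (ce g') (ce g'))
  (@gmap_linear _ _ _ _ _ (ce_measuring Psi y) (ce_measuring Psi v))
  (@gmap_bd _ (ce g) (ce g) (ce g') (ce g') (ce_measuring Psi y) (ce_measuring Psi v)
    (ml y) (ml v) (mbd y) (mbd v)) cD.
rewrite (@hclass_sweedler _ _ (tensor_complex (ce g') (ce g')) _ _ _ _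
  (fun y v => (gm y v).1)).2; last first.
  apply: gmap_bil => m; exact: ce_measuring_bil.
apply: sweedler_ext => y v.
rewrite -(gm y v).2 -DE.
exact: (esym (kunneth_natural (ml y) (ml v) (mbd y) (mbd v) w)).
Qed.
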